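(* Let $AB$ be a bipartite quantum system in which either $A$ or $B$ is a single qubit, i.e. $\min\{|A|,|B|\}=2$. Then for all states $\rho=\rho_{AB}$ it holds that $$E_{c,\mathrm{PPT}}^{\mathrm{exact}}(\rho)=E_{\chi,1}(\rho)=\log_2\min\left\{\big\|S_0^\Gamma\big\|_1:\ -S_0\leq\rho^\Gamma\leq S_0\right\}=E_\kappa(\rho)\,.$$
   Context: All Hilbert spaces are finite-dimensional and complex; $|A|$ is the dimension of $\mathcal{H}_A$. A state on $AB$ is a positive semi-definite unit-trace operator on $\mathcal{H}_A\otimes\mathcal{H}_B$. $X\leq Y$ means $Y-X$ is positive semi-definite; $\|X\|_1=\mathrm{Tr}\sqrt{X^\dagger X}$. $\Gamma$ is the partial transpose on the second party: the linear map with $(X_A\otimes Y_B)^\Gamma=X_A\otimes Y_B^{\intercal}$ (transpose in a fixed basis). $\rho^{\otimes n}$ is regarded as a bipartite state with parties $A^n$ and $B^n$. Minima below are over Hermitian operators on $\mathcal{H}_A\otimes\mathcal{H}_B$. $E_{\chi,1}(\rho):=\log_2\min\{\mathrm{Tr}\,S_1:\ -S_0\leq\rho^\Gamma\leq S_0,\ -S_1\leq S_0^\Gamma\leq S_1\}$ and $E_\kappa(\rho):=\log_2\min\{\mathrm{Tr}\,S:\ -S\leq\rho^\Gamma\leq S,\ S^\Gamma\geq0\}$. A completely positive map $\Lambda$ from operators on $AB$ to operators on $A'B'$ is PPT if $\Gamma_{B'}\circ\Lambda\circ\Gamma_B$ is also completely positive; a PPT channel is a trace-preserving PPT map. With $\Phi_2=|\Phi_2\rangle\langle\Phi_2|$,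 $|\Phi_2\rangle=\frac{1}{\sqrt2}(|00\rangle+|11\rangle)$, the zero-error PPT entanglement cost is $$E_{c,\mathrm{PPT}}^{\mathrm{exact}}(\rho):=\inf\{R:\ \text{for all sufficiently large } n\in\mathbb{N}\ \exists\text{ a PPT channel }\Lambda_n\text{ with }\Lambda_n(\Phi_2^{\otimes\lfloor Rn\rfloor})=\rho^{\otimes n}\}.$$ *)

(* Defs.v *)
(* MathComp and MathComp-Analysis; the complex scalars are R[i], R : realType. *)
From mathcomp Require Import all_boot all_order all_algebra.
From mathcomp Require Import spectral sesquilinear complex.
From mathcomp Require Import all_classical all_reals all_analysis.

Set Implicit Arguments.
Unset Strict Implicit.
Unset Printing Implicit Defensive.

Import Order.TTheory GRing.Theory Num.Theory.
Local Open Scope classical_set_scope.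
Local Open Scope ring_scope.
Local Open Scope sesquilinear_scope.
Local Open Scope complex_scope.

(* A Hilbert space is given by a finite type I labelling its fixed orthonormal
   basis, so its dimension is #|I|.  The composite of I and J is I * J, and n
   copies of I form {ffun 'I_n -> I}. *)
Notation op R I := 'M[R[i]]_#|{: I}|.

Definition entry (R : realType) (I : finType) (X : op R I) (x y : I) : R[i] :=
  X (enum_rank x) (enum_rank y).

Definition mkop (R : realType) (I : finType) (f : I -> I -> R[i]) : op R I :=
  \matrix_(i, j) f (enum_val i) (enum_val j).

Definition psd (R : realType) (n : nat) (X : 'M[R[i]]_n) : Prop :=
  X \is hermsymmx /\ forall v : 'cV[R[i]]_n, 0 <= (v ^t* *m X *m v) 0 0.

Definition loewner_le (R : realType) (n : nat) (X Y : 'M[R[i]]_n) : Prop :=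
  psd (Y - X).

Definition state (R : realType) (n : nat) (rho : 'M[R[i]]_n) : Prop :=
  psd rho /\ \tr rho = 1.

(* Functional calculus, for Hermitian X; see mxsqrtP. *)
Definition mxsqrt (R : realType) (n : nat) (X : 'M[R[i]]_n) : 'M[R[i]]_n :=
  invmx (spectralmx X) *m diag_mx (map_mx sqrtC (spectral_diag X))
    *m spectralmx X.

(* The trace is a nonnegative real number; Re only casts it to R. *)
Definition trace_norm (R : realType) (n : nat) (X : 'M[R[i]]_n) : R :=
  complex.Re (\tr (mxsqrt (X ^t* *m X))).

Definition tens (R : realType) (I J : finType) (X : op R I) (Y : op R J)
    : op R (I * J) :=
  mkop (fun x y => entry X x.1 y.1 * entry Y x.2 y.2).

(* See ptrans_tens. *)
Definition ptrans (R : realType) (I J : finType) (X : op R (I * J))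
    : op R (I * J) :=
  mkop (fun x y => entry X (x.1, y.2) (y.1, x.2)).

(* The n-th tensor power, with the factors regrouped as I^n and J^n. *)
Definition tpow (R : realType) (I J : finType) (X : op R (I * J)) (n : nat)
    : op R ({ffun 'I_n -> I} * {ffun 'I_n -> J}) :=
  mkop (fun x y : {ffun 'I_n -> I} * {ffun 'I_n -> J} =>
    \prod_(t < n) entry X (x.1 t, x.2 t) (y.1 t, y.2 t)).

Definition ket_Phi2 (R : realType) : 'cV[R[i]]_#|{: 'I_2 * 'I_2}| :=
  \col_i (let x : 'I_2 * 'I_2 := enum_val i in (x.1 == x.2)%:R / sqrtC 2).

Definition Phi2 (R : realType) : op R ('I_2 * 'I_2) :=
  ket_Phi2 R *m (ket_Phi2 R) ^t*.

(* The map id_k (x) L: apply L to each block of X. *)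
Definition ampliation (R : realType) (I J : finType) (k : nat)
    (L : op R I -> op R J) (X : op R ('I_k * I)) : op R ('I_k * J) :=
  mkop (fun x y =>
    entry (L (mkop (fun i j => entry X (x.1, i) (y.1, j)))) x.2 y.2).

Definition completely_positive (R : realType) (I J : finType)
    (L : op R I -> op R J) : Prop :=
  linear L /\
  forall (k : nat) (X : op R ('I_k * I)), psd X -> psd (ampliation L X).

Definition trace_preserving (R : realType) (I J : finType)
    (L : op R I -> op R J) : Prop :=
  forall X : op R I, \tr (L X) = \tr X.

Definition ppt_map (R : realType) (A B A' B' : finType)
    (L : op R (A * B) -> op R (A' * B')) : Prop :=
  completely_positive L /\
  completely_positive (fun X : op R (A * B) => ptrans (L (ptrans X))).

Definition ppt_channel (R : realType) (A B A' B' : finType)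
    (L : op R (A * B) -> op R (A' * B')) : Prop :=
  ppt_map L /\ trace_preserving L.

(* Rates are nonnegative, the number floor(r n) of input pairs being a natural
   number; Num.truncn is the floor there. *)
Definition achievable (R : realType) (A B : finType) (rho : op R (A * B))
    : set R :=
  [set r : R | 0 <= r /\
    \forall n \near \oo,
      exists L : op R ({ffun 'I_(Num.truncn (r * n%:R)) -> 'I_2} *
                       {ffun 'I_(Num.truncn (r * n%:R)) -> 'I_2}) ->
                 op R ({ffun 'I_n -> A} * {ffun 'I_n -> B}),
        ppt_channel L /\
        L (tpow (Phi2 R) (Num.truncn (r * n%:R))) = tpow rho n].

Definition exact_ppt_cost (R : realType) (A B : finType) (rho : op R (A * B))
    : \bar R := ereal_inf [set r%:E | r in achievable rho].

Definition log2 (R : realType) (x : R) : R := ln x / ln 2.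

Definition between (R : realType) (n : nat) (S X : 'M[R[i]]_n) : Prop :=
  loewner_le (- S) X /\ loewner_le X S.

Definition has_minimum (R : realType) (V : set R) : Prop :=
  exists2 m : R, V m & lbound V m.

(* Objective values of the three minimisations; traces of Hermitian operators
   are real, and Re only casts them to R. *)
Definition chi1_values (R : realType) (A B : finType) (rho : op R (A * B))
    : set R :=
  [set m : R | exists S0 S1 : op R (A * B),
    [/\ S0 \is hermsymmx, S1 \is hermsymmx,
        between S0 (ptrans rho), between S1 (ptrans S0)
      & m = complex.Re (\tr S1)]].

Definition norm_values (R : realType) (A B : finType) (rho : op R (A * B))
    : set R :=
  [set m : R | exists S0 : op R (A * B),
    [/\ S0 \is hermsymmx, between S0 (ptrans rho)
      & m = trace_norm (ptrans S0)]].

Definition kappa_values (R : realType) (A B : finType) (rho : op R (A * B))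
    : set R :=
  [set m : R | exists S : op R (A * B),
    [/\ S \is hermsymmx, between S (ptrans rho), psd (ptrans S)
      & m = complex.Re (\tr S)]].

(* The real infimum inf V is the minimum of V exactly when has_minimum V. *)
Definition E_chi1 (R : realType) (A B : finType) (rho : op R (A * B)) : R :=
  log2 (inf (chi1_values rho)).

Definition E_kappa (R : realType) (A B : finType) (rho : op R (A * B)) : R :=
  log2 (inf (kappa_values rho)).

Section Facts.
Context {R : realType}.

Lemma entry_mkop (I : finType) (f : I -> I -> R[i]) (x y : I) :
  entry (mkop f) x y = f x y.
Proof. by rewrite /entry mxE !enum_rankK. Qed.

Lemma ptrans_tens (I J : finType) (X : op R I) (Y : op R J) :
  ptrans (tens X Y) = tens X Y^T.
Proof.
apply/matrixP => i j; rewrite !mxE entry_mkop /=; congr (_ * _).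
by rewrite /entry mxE.
Qed.

Lemma adjmxM (m n p : nat) (X : 'M[R[i]]_(m, n)) (Y : 'M[R[i]]_(n, p)) :
  (X *m Y) ^t* = Y ^t* *m X ^t*.
Proof. by rewrite trmx_mul map_mxM. Qed.

Lemma hermP (n : nat) (X : 'M[R[i]]_n) : reflect (X = X ^t*) (X \is hermsymmx).
Proof. by apply: (iffP (is_hermitianmxP _ _ _)); rewrite expr0 scale1r. Qed.

Lemma psd_spectral_ge0 (n : nat) (X : 'M[R[i]]_n) (k : 'I_n) :
  psd X -> 0 <= spectral_diag X 0 k.
Proof.
move=> [hX pX]; have /orthomx_spectralP eX := hermitian_normalmx hX.
have U := spectral_unitarymx X; have /unitarymxP UU := U.
have := pX ((spectralmx X) ^t* *m delta_mx k 0).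
rewrite adjmxM trmxCK {2}eX invmx_unitary // !mulmxA.
rewrite -[_ *m spectralmx X *m _]mulmxA UU mulmx1.
rewrite -[_ *m spectralmx X *m _]mulmxA UU mulmx1.
rewrite trmx_delta map_delta_mx -rowE -colE !mxE.
by rewrite eqxx mulr1n.
Qed.

Lemma mxsqrtP (n : nat) (X : 'M[R[i]]_n) :
  psd X -> psd (mxsqrt X) /\ mxsqrt X *m mxsqrt X = X.
Proof.
move=> pX; have [hX _] := pX.
have /orthomx_spectralP eX := hermitian_normalmx hX.
have U := spectral_unitarymx X; have /unitarymxP UU := U.
have d0 k := psd_spectral_ge0 k pX.
set d := map_mx sqrtC (spectral_diag X).
have dE k : d 0 k = sqrtC (spectral_diag X 0 k) by rewrite mxE.
have dp k : 0 <= d 0 k by rewrite dE sqrtC_ge0.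
have hd : (diag_mx d) ^t* = diag_mx d.
  apply/matrixP => i j; rewrite !mxE eq_sym; case: eqP => [->|_] /=.
    by rewrite !mulr1n -dE; exact: geC0_conj.
  by rewrite !mulr0n rmorph0.
split; last first.
  rewrite /mxsqrt -/d invmx_unitary // !mulmxA.
  rewrite -[_ *m spectralmx X *m _]mulmxA UU mulmx1.
  rewrite -[_ *m diag_mx d *m diag_mx d]mulmxA mulmx_diag.
  rewrite [RHS]eX invmx_unitary //; congr (_ *m diag_mx _ *m _).
  by apply/rowP => k; rewrite !mxE -expr2 sqrtCK.
split.
  apply/hermP; rewrite /mxsqrt -/d invmx_unitary // !adjmxM trmxCK hd.
  by rewrite mulmxA.
move=> v; rewrite /mxsqrt -/d invmx_unitary // !mulmxA -[_ *m v]mulmxA.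
rewrite -adjmxM -mulmxA [diag_mx d *m _]mul_diag_mx mxE; apply: sumr_ge0 => k _.
rewrite !mxE mulrCA; apply: mulr_ge0; first by rewrite -dE.
by rewrite mulrC -normCK exprn_ge0.
Qed.

End Facts.

(* Main.v *)
Require Import Defs.
From mathcomp Require Import all_boot all_order all_algebra.
From mathcomp Require Import spectral sesquilinear complex.
From mathcomp Require Import all_classical all_reals all_analysis.
From mathcomp Require Import ring lra.

(* Let G be the partial transposition and Z the sign flip of the qubit.  For
   N >= 0 the operator N + Z N Z is block diagonal with respect to the qubit,
   so its partial transpose is again >= 0.  This has two consequences.

   If -S1 <= S0^G <= S1, put N = (S1 - S0^G) / 2.  Then S = S0 + (N + Z N Z)^G
   satisfies S >= S0, S^G >= 0 and Tr S = Tr S1.  Hence the three minimisations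
   have the same objective values.

   If X >= 0 and X^G <= 1, then X^G >= -1.  Hence an optimal dual solution
   P, Q >= 0, (P + Q)^G <= 1 of the program of E_kappa satisfies
   -1 <= (P + Q)^G <= 1, and this, like -(P + Q) <= P - Q <= P + Q, passes to
   tensor powers: the optimal value m of rho becomes exactly m ^ n for
   n copies.

   A PPT channel preparing the n-th tensor power of rho from k maximally
   entangled pairs yields a feasible S of trace 2 ^ k, so m ^ n <= 2 ^ k.
   Conversely, when Tr S + 1 <= 2 ^ k, the channel which measures whether the
   input is maximally entangled and prepares rho or S^G / Tr S is PPT. *)

Set Implicit Arguments.
Unset Strict Implicit.
Unset Printing Implicit Defensive.

Import Order.TTheory GRing.Theory Num.Theory.
Import numFieldNormedType.Exports.
Local Open Scope ring_scope.
Local Open Scope sesquilinear_scope.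

(** * Positive semidefinite matrices *)

Section Psd.
Context {R : realType}.
Local Notation C := R[i].

Lemma op_ext (I : finType) (X Y : op R I) :
  (forall x y, entry X x y = entry Y x y) -> X = Y.
Proof.
move=> eXY; apply/matrixP => i j.
by have := eXY (enum_val i) (enum_val j); rewrite /entry !enum_valK.
Qed.

Lemma sum_enum_val (I : finType) (F : 'I_#|{: I}| -> C) :
  \sum_i F i = \sum_x F (enum_rank x).
Proof.
rewrite (reindex (@enum_rank I)) //.
by exists enum_val => x _; rewrite ?enum_rankK ?enum_valK.
Qed.

Lemma entry_mul (I : finType) (X Y : op R I) x y :
  entry (X *m Y) x y = \sum_z entry X x z * entry Y z y.
Proof. by rewrite /entry mxE sum_enum_val. Qed.

Lemma tr_entry (I : finType) (X : op R I) : \tr X = \sum_x entry X x x.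
Proof. by rewrite /mxtrace sum_enum_val. Qed.

Lemma entryD (I : finType) (X Y : op R I) x y :
  entry (X + Y) x y = entry X x y + entry Y x y.
Proof. by rewrite /entry mxE. Qed.

Lemma entryB (I : finType) (X Y : op R I) x y :
  entry (X - Y) x y = entry X x y - entry Y x y.
Proof. by rewrite /entry !mxE. Qed.

Lemma entryZ (I : finType) a (X : op R I) x y :
  entry (a *: X) x y = a * entry X x y.
Proof. by rewrite /entry !mxE. Qed.

Lemma entry1 (I : finType) (x y : I) :
  entry (1%:M : op R I) x y = (x == y)%:R.
Proof. by rewrite /entry mxE (inj_eq enum_rank_inj). Qed.

Lemma tr_mul_entry (I : finType) (X Y : op R I) :
  \tr (X *m Y) = \sum_x \sum_y entry X x y * entry Y y x.
Proof. by rewrite tr_entry; apply: eq_bigr => x _; rewrite entry_mul. Qed.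

Lemma psd_gram (n m : nat) (X : 'M[C]_(n, m)) : psd (X *m X ^t*).
Proof.
split; first by apply/hermP; rewrite adjmxM trmxCK.
move=> v; rewrite mulmxA -[_ *m v]mulmxA -[X in X ^t* *m v]trmxCK.
set w := v ^t* *m X; rewrite trmxCK.
have -> : X ^t* *m v = w ^t* by rewrite /w adjmxM trmxCK.
by rewrite mxE; apply: sumr_ge0 => k _; rewrite !mxE -normCK exprn_ge0.
Qed.

Lemma psd_root (n : nat) (X : 'M[C]_n) :
  psd X -> exists Y : 'M[C]_n, X = Y *m Y ^t*.
Proof.
move=> /mxsqrtP[[/hermP h _] e]; exists (mxsqrt X).
by rewrite -h e.
Qed.

(** The columns of a root of [X] serve as Gram vectors. Together with [psd_entry] this reduces
    positivity of blocks, tensor products and measure-and-prepare maps to the choice of a family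
    [c]. *)
Lemma psd_entryP (I : finType) (X : op R I) :
  psd X -> exists c : I -> I -> C,
    forall x y, entry X x y = \sum_k c k x * (c k y)^*.
Proof.
move=> /psd_root[Y ->]; exists (fun k x => entry Y x k) => x y.
by rewrite /entry mxE sum_enum_val; apply: eq_bigr => k _; rewrite !mxE.
Qed.

Lemma psd_entry (I K : finType) (X : op R I) (c : K -> I -> C) :
  (forall x y, entry X x y = \sum_k c k x * (c k y)^*) -> psd X.
Proof.
move=> eX.
pose Y : 'M[C]_(#|{: I}|, #|{: K}|) :=
  \matrix_(i, k) c (enum_val k) (enum_val i).
suff -> : X = Y *m Y ^t* by exact: psd_gram.
apply: op_ext => x y; rewrite eX /entry mxE sum_enum_val.
by apply: eq_bigr => k _; rewrite !mxE !enum_rankK.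
Qed.

Lemma psd_herm (n : nat) (X : 'M[C]_n) : psd X -> X \is hermsymmx.
Proof. by case. Qed.

Lemma hermD (n : nat) (X Y : 'M[C]_n) :
  X \is hermsymmx -> Y \is hermsymmx -> X + Y \is hermsymmx.
Proof.
move=> /hermP hX /hermP hY; apply/hermP.
by rewrite linearD map_mxD -hX -hY.
Qed.

Lemma hermN (n : nat) (X : 'M[C]_n) : X \is hermsymmx -> - X \is hermsymmx.
Proof. by move=> /hermP hX; apply/hermP; rewrite linearN map_mxN -hX. Qed.

Lemma hermB (n : nat) (X Y : 'M[C]_n) :
  X \is hermsymmx -> Y \is hermsymmx -> X - Y \is hermsymmx.
Proof. by move=> hX hY; exact/hermD/hermN. Qed.

Lemma hermZ (n : nat) (a : C) (X : 'M[C]_n) :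
  a \is Num.real -> X \is hermsymmx -> a *: X \is hermsymmx.
Proof.
move=> /CrealP ra /hermP hX; apply/hermP.
by rewrite linearZ map_mxZ -hX /= ra.
Qed.

Lemma psdD (n : nat) (X Y : 'M[C]_n) : psd X -> psd Y -> psd (X + Y).
Proof.
move=> [hX pX] [hY pY]; split; first exact: hermD.
by move=> v; rewrite mulmxDr mulmxDl mxE addr_ge0.
Qed.

Lemma psdZ (n : nat) (a : C) (X : 'M[C]_n) : 0 <= a -> psd X -> psd (a *: X).
Proof.
move=> a0 [hX pX]; split; first exact/hermZ/hX/ger0_real.
by move=> v; rewrite -scalemxAr -scalemxAl mxE mulr_ge0.
Qed.

Lemma psd0 (n : nat) : psd (0 : 'M[C]_n).
Proof. by have := psd_gram (0 : 'M[C]_n); rewrite mul0mx. Qed.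

Lemma psd1 (n : nat) : psd (1%:M : 'M[C]_n).
Proof. by have := psd_gram (1%:M : 'M[C]_n); rewrite trmx1 map_mx1 mulmx1. Qed.

Lemma psd_sum (n : nat) (K : finType) (X : K -> 'M[C]_n) :
  (forall k, psd (X k)) -> psd (\sum_k X k).
Proof.
move=> pX; apply: (big_ind (@psd R n)).
- exact: psd0.
- by move=> x y; apply: psdD.
- by move=> k _; exact: pX.
Qed.

Lemma psd_tr_ge0 (n : nat) (X : 'M[C]_n) : psd X -> 0 <= \tr X.
Proof.
move=> /psd_root[Y ->]; apply: sumr_ge0 => i _.
rewrite mxE; apply: sumr_ge0 => k _.
by rewrite !mxE -normCK exprn_ge0.
Qed.

Lemma psd_trM_ge0 (n : nat) (X Y : 'M[C]_n) :
  psd X -> psd Y -> 0 <= \tr (X *m Y).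
Proof.
move=> /psd_root[Z ->] /psd_root[W ->].
rewrite -(mulmxA Z) mxtrace_mulC (mulmxA (Z ^t* )) -(mulmxA (Z ^t* *m W)).
have -> : W ^t* *m Z = (Z ^t* *m W) ^t* by rewrite adjmxM trmxCK.
by apply: psd_tr_ge0; exact: psd_gram.
Qed.

(** The rank-one tests [v *m v ^t*] already recover the quadratic form of [X]. *)
Lemma psd_dual (n : nat) (X : 'M[C]_n) :
  X \is hermsymmx -> (forall Y, psd Y -> 0 <= \tr (X *m Y)) -> psd X.
Proof.
move=> hX pX; split => // v; have := pX _ (psd_gram v).
by rewrite mulmxA mxtrace_mulC mulmxA trace_mx11.
Qed.

End Psd.

(** * Partial transposition and a qubit factor *)

Section Ptrans.
Context {R : realType}.
Local Notation C := R[i].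

Lemma entry_ptrans (I J : finType) (X : op R (I * J)) x y :
  entry (ptrans X) x y = entry X (x.1, y.2) (y.1, x.2).
Proof. exact: entry_mkop. Qed.

Lemma herm_entry (I : finType) (X : op R I) :
  X \is hermsymmx <-> forall x y, entry X x y = (entry X y x)^*.
Proof.
split=> [/hermP h x y|h]; first by rewrite {1}h /entry !mxE.
by apply/hermP; apply: op_ext => x y; rewrite h /entry !mxE.
Qed.

Lemma ptransK (I J : finType) : involutive (@ptrans R I J).
Proof.
by move=> X; apply: op_ext => -[x1 x2] [y1 y2]; rewrite !entry_ptrans.
Qed.

Lemma ptransD (I J : finType) (X Y : op R (I * J)) :
  ptrans (X + Y) = ptrans X + ptrans Y.
Proof. by apply: op_ext => x y; rewrite entryD !entry_ptrans entryD. Qed.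

Lemma ptransZ (I J : finType) a (X : op R (I * J)) :
  ptrans (a *: X) = a *: ptrans X.
Proof. by apply: op_ext => x y; rewrite entryZ !entry_ptrans entryZ. Qed.

Lemma ptransN (I J : finType) (X : op R (I * J)) : ptrans (- X) = - ptrans X.
Proof. by rewrite -scaleN1r ptransZ scaleN1r. Qed.

Lemma ptransB (I J : finType) (X Y : op R (I * J)) :
  ptrans (X - Y) = ptrans X - ptrans Y.
Proof. by rewrite ptransD ptransN. Qed.

Lemma ptrans1 (I J : finType) : ptrans (1%:M : op R (I * J)) = 1%:M.
Proof.
apply: op_ext => -[x1 x2] [y1 y2]; rewrite entry_ptrans !entry1 /=.
by rewrite !xpair_eqE (eq_sym x2).
Qed.

Lemma tr_ptrans (I J : finType) (X : op R (I * J)) : \tr (ptrans X) = \tr X.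
Proof.
by rewrite !tr_entry; apply: eq_bigr => -[x1 x2] _; rewrite entry_ptrans.
Qed.

Lemma tr_ptransM (I J : finType) (X Y : op R (I * J)) :
  \tr (ptrans X *m ptrans Y) = \tr (X *m Y).
Proof.
rewrite !tr_mul_entry !pair_bigA /=.
pose f (p : (I * J) * (I * J)) := ((p.1.1, p.2.2), (p.2.1, p.1.2)).
have fK : involutive f by move=> [[? ?] [? ?]].
rewrite [RHS](reindex_inj (inv_inj fK)) /=.
by apply: eq_bigr => -[x y] _ /=; rewrite !entry_ptrans.
Qed.

Lemma tr_ptransMl (I J : finType) (X Y : op R (I * J)) :
  \tr (ptrans X *m Y) = \tr (X *m ptrans Y).
Proof. by rewrite -{1}(ptransK Y) tr_ptransM. Qed.

Lemma herm_ptrans (I J : finType) (X : op R (I * J)) :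
  X \is hermsymmx -> ptrans X \is hermsymmx.
Proof.
move=> /herm_entry h; apply/herm_entry => x y; rewrite !entry_ptrans; exact: h.
Qed.

(** The sign is [-1] at a chosen [a0] and [1] at the other point; with only two points, distinct
    ones have opposite signs. The dimension of the qubit enters the proof only through this
    identity. *)
Lemma qubit_sign (A : finType) : #|A| = 2%N ->
  exists s : A -> C, (forall a, (s a)^* = s a) /\
    forall a b, s a * s b = 2 * (a == b)%:R - 1.
Proof.
move=> cA; have /card_gt0P[a0 _] : (0 < #|A|)%N by rewrite cA.
exists (fun a => (-1) ^+ (a == a0)); split=> [a|a b].
  by rewrite rmorph_sign.
move=> /=; case: (eqVneq a a0) => [->|na]; case: (eqVneq b a0) => [eb|nb]; try rewrite eb;
  rewrite ?expr1 ?expr0 ?eqxx ?(negbTE na) //.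
- by rewrite mulr1n; ring.
- by rewrite mulr0n; ring.
- by rewrite mulr0n; ring.
have -> : (a == b) = true.
  apply: contraT => nab; have : (2 < #|A|)%N.
    apply/card_gt2P; exists a, b, a0; split; rewrite ?inE //; split=> //.
    by rewrite eq_sym.
  by rewrite cA.
by rewrite mulr1n; ring.
Qed.

(* [Z N Z] with [Z] a diagonal sign matrix. *)
Definition sconj (I : finType) (s : I -> C) (N : op R I) : op R I :=
  mkop (fun x y => s x * s y * entry N x y).

Lemma psd_sconj (I : finType) (s : I -> C) (N : op R I) :
  (forall x, (s x)^* = s x) -> psd N -> psd (sconj s N).
Proof.
move=> sr /psd_entryP[c Nc].
apply: (psd_entry (c := fun k x => s x * c k x)) => x y.
rewrite entry_mkop Nc mulr_sumr; apply: eq_bigr => k _.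
by rewrite rmorphM /= sr; ring.
Qed.

Lemma tr_sconj (I : finType) (s : I -> C) (N : op R I) :
  (forall x, s x * s x = 1) -> \tr (sconj s N) = \tr N.
Proof.
by move=> s1; rewrite !tr_entry; apply: eq_bigr => x _; rewrite entry_mkop s1 mul1r.
Qed.

Lemma entry_sum (I K : finType) (X : K -> op R I) x y :
  entry (\sum_k X k) x y = \sum_k entry (X k) x y.
Proof. by rewrite /entry summxE. Qed.

Lemma sum_delta2 (K : finType) (a b : K) (F : K -> C) :
  \sum_k (a == k)%:R * (b == k)%:R * F k = (a == b)%:R * F a.
Proof.
rewrite (bigD1 a) //= big1 ?addr0 ?eqxx ?mul1r ?[b == a]eq_sym //.
by move=> k /negbTE nk; rewrite eq_sym nk !mul0r.
Qed.

(* With [Z] the sign flip of the qubit, [N + Z N Z] is block diagonal with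
   respect to the qubit, and the partial transpose transposes (or permutes)
   its blocks. *)
Lemma qubit_dephasing (A B : finType) (hAB : minn #|A| #|B| = 2%N)
    (N : op R (A * B)) : psd N ->
  exists M, [/\ psd M, \tr M = \tr N & psd (ptrans (N + M))].
Proof.
move=> pN; have [c Nc] := psd_entryP pN.
have [cA|cB] : #|A| = 2%N \/ #|B| = 2%N.
  by move: hAB; rewrite /minn; case: ifP; auto.
- have [s [sr sE]] := qubit_sign cA.
  exists (sconj (fun x => s x.1) N); split.
  + by apply: psd_sconj.
  + by apply: tr_sconj => x; rewrite sE eqxx mulr1n; ring.
  pose X a : op R (A * B) := mkop (fun x y =>
    (x.1 == a)%:R * (y.1 == a)%:R * entry N (a, y.2) (a, x.2)).
  suff -> : ptrans (N + sconj (fun x => s x.1) N) = 2 *: \sum_a X a.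
    apply: psdZ; first by rewrite ler0n.
    apply: psd_sum => a.
    (* Conjugated Gram vectors of [N], cut down to the block [a], are Gram vectors of the transposed
       block. *)
    apply: (psd_entry (c := fun k x => (x.1 == a)%:R * (c k (a, x.2))^*)) => x y.
    rewrite entry_mkop Nc mulr_sumr; apply: eq_bigr => k _.
    rewrite rmorphM /= conjCK rmorph_nat; ring.
  (* The factor [1 + s x.1 * s y.1] is [2] for equal qubit indices and [0] otherwise, so the
     diagonal blocks double and the others cancel. *)
  apply: op_ext => x y; rewrite entry_ptrans entryD entryZ entry_sum entry_mkop /=.
  under [in RHS]eq_bigr do rewrite entry_mkop.
  rewrite (sum_delta2 _ _ (fun a => entry N (a, y.2) (a, x.2))) sE.
  by have [->|_] := eqVneq x.1 y.1; rewrite ?mulr1n ?mulr0n; ring.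
- have [s [sr sE]] := qubit_sign cB.
  exists (sconj (fun x => s x.2) N); split.
  + by apply: psd_sconj.
  + by apply: tr_sconj => x; rewrite sE eqxx mulr1n; ring.
  pose X b : op R (A * B) := mkop (fun x y =>
    (x.2 == b)%:R * (y.2 == b)%:R * entry N (x.1, b) (y.1, b)).
  suff -> : ptrans (N + sconj (fun x => s x.2) N) = 2 *: \sum_a X a.
    apply: psdZ; first by rewrite ler0n.
    apply: psd_sum => a.
    apply: (psd_entry (c := fun k x => (x.2 == a)%:R * c k (x.1, a))) => x y.
    rewrite entry_mkop Nc mulr_sumr; apply: eq_bigr => k _.
    by rewrite rmorphM /= rmorph_nat; ring.
  apply: op_ext => x y; rewrite entry_ptrans entryD entryZ entry_sum entry_mkop /=.
  under [in RHS]eq_bigr do rewrite entry_mkop.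
  rewrite (sum_delta2 _ _ (fun b => entry N (x.1, b) (y.1, b))) sE eq_sym.
  by have [->|_] := eqVneq x.2 y.2; rewrite ?mulr1n ?mulr0n; ring.
Qed.

End Ptrans.

(** * Absolute values of Hermitian matrices *)

Section Sqrt.
Context {R : realType}.
Local Notation C := R[i].

(** By the spectral theorem a negative diagonal entry would come with the eigenvector [V ^t* *m w],
    which is nonzero because [V] is unitary. *)
Lemma psd_eigen (n : nat) (X : 'M[C]_n) : X \is hermsymmx ->
  (forall (v : 'cV[C]_n) (a : C), a < 0 -> X *m v = a *: v -> v = 0) -> psd X.
Proof.
move=> hX eig.
have /orthomx_spectralP eX := hermitian_normalmx hX.
have /mxOverP dr := hermitian_spectral_diag_real hX.
have U := spectral_unitarymx X; have /unitarymxP UU := U.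
rewrite invmx_unitary // in eX; move: eX dr UU.
set d := spectral_diag X; set V := spectralmx X => eX dr UU.
have d0 k : 0 <= d 0 k.
  rewrite real_leNgt ?dr ?real0 //; apply/negP => dk.
  pose w : 'cV[C]_n := delta_mx k 0.
  have v0 := eig (V ^t* *m w) _ dk.
  have e : X *m (V ^t* *m w) = d 0 k *: (V ^t* *m w).
    have XV : X *m V ^t* = V ^t* *m diag_mx d.
      by rewrite {1}eX -(mulmxA _ V) UU mulmx1.
    rewrite mulmxA XV -mulmxA scalemxAr; congr (_ *m _).
    apply/matrixP => i j; rewrite /w mul_diag_mx !mxE.
    by have [->|] := eqVneq i k; rewrite ?andFb ?mulr0.
  have {e v0} := v0 e.
  move=> /(congr1 (mulmx V)); rewrite mulmxA UU mul1mx mulmx0 /w.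
  move=> /matrixP /(_ k 0); rewrite !mxE !eqxx => /eqP.
  by rewrite oner_eq0.
split => // v; rewrite eX.
have -> : v ^t* *m (V ^t* *m diag_mx d *m V) *m v =
    (V *m v) ^t* *m (diag_mx d *m (V *m v)) by rewrite adjmxM !mulmxA.
rewrite mxE; apply: sumr_ge0 => k _; rewrite mul_diag_mx !mxE.
by rewrite mulrCA mulr_ge0 // mulrC -normCK exprn_ge0.
Qed.

Lemma adjmxB (n m : nat) (X Y : 'M[C]_(n, m)) : (X - Y) ^t* = X ^t* - Y ^t*.
Proof. by apply/matrixP => i j; rewrite !mxE rmorphB. Qed.

Lemma adjmxZ (n m : nat) (a : C) (X : 'M[C]_(n, m)) :
  (a *: X) ^t* = a^* *: X ^t*.
Proof. by apply/matrixP => i j; rewrite !mxE rmorphM. Qed.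

(** Let [v] be an eigenvector of [T - Y] with eigenvalue [a < 0]. Substituting [Y v = T v - a v]
    into [|T v|^2 = |Y v|^2] leaves [2 <v, T v> = a |v|^2]. The left side is non-negative and the
    right side non-positive, so [v = 0]. *)
Lemma psd_sqrt_dominates (n : nat) (T Y : 'M[C]_n) :
  psd T -> Y \is hermsymmx -> T *m T = Y *m Y -> psd (T - Y).
Proof.
move=> pT hY TY; have hT := psd_herm pT.
apply: psd_eigen; first exact: hermB.
move=> v a a0; rewrite mulmxBl => /eqP; rewrite subr_eq => /eqP Tv.
have ra : a^* = a by apply/CrealP/ltr0_real.
have vE : Y *m v = T *m v - a *: v by rewrite Tv addrAC subrr add0r.
have quad (X : 'M[C]_n) : X \is hermsymmx ->
    v ^t* *m (X *m X) *m v = (X *m v) ^t* *m (X *m v).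
  by move=> /hermP hX; rewrite adjmxM -hX !mulmxA.
have := congr1 (fun X => (v ^t* *m X *m v) 0 0) TY.
rewrite !quad // vE.
have -> : (T *m v - a *: v) ^t* *m (T *m v - a *: v) =
    (T *m v) ^t* *m (T *m v) - (2 * a) *: (v ^t* *m T *m v)
      + a ^+ 2 *: (v ^t* *m v).
  have -> : (T *m v - a *: v) ^t* = v ^t* *m T - a *: v ^t*.
    by rewrite adjmxB adjmxZ ra adjmxM -(hermP _ hT).
  rewrite adjmxM -(hermP _ hT) mulmxBl !mulmxBr.
  rewrite -!scalemxAl -!scalemxAr !mulmxA scalerA -expr2.
  by rewrite mulr_natl mulr2n scalerDl opprB opprD !addrA addrAC.
have E (c d : C) (U V W : 'M[C]_1) :
    (U - c *: V + d *: W) 0 0 = U 0 0 - c * V 0 0 + d * W 0 0.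
  by rewrite !mxE.
rewrite E => /eqP; rewrite -subr_eq0 !opprD !addrA subrr sub0r opprK subr_eq0.
move=> /eqP e.
have q0 : 0 <= (v ^t* *m v) 0 0.
  by rewrite mxE; apply: sumr_ge0 => k _; rewrite !mxE mulrC -normCK exprn_ge0.
have {}e : 2 * (v ^t* *m T *m v) 0 0 = a * (v ^t* *m v) 0 0.
  apply: (mulfI (ltr0_neq0 a0)); rewrite [RHS]mulrA -expr2 -e.
  by rewrite mulrCA [LHS]mulrA.
have : (v ^t* *m v) 0 0 == 0.
  have : 0 <= a * (v ^t* *m v) 0 0.
    by rewrite -e; apply: mulr_ge0; [exact: ler0n | case: pT].
  by rewrite nmulr_rge0 // => qle; rewrite eq_le qle q0.
rewrite mxE psumr_eq0 => [/allP vz|k _]; last first.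
  by rewrite !mxE mulrC -normCK exprn_ge0.
apply/colP => k; have := vz k (mem_index_enum k).
by rewrite !mxE /= mulf_eq0 conjC_eq0 orbb => /eqP.
Qed.

End Sqrt.

(** * Equality of the three sets of objective values *)

Section Values.
Context {R : realType}.
Local Notation C := R[i].
Opaque psd.

Lemma betweenE (n : nat) (S X : 'M[C]_n) :
  between S X <-> psd (S + X) /\ psd (S - X).
Proof. by rewrite /between /loewner_le opprK [X + S]addrC. Qed.

Lemma two_neq0 : (2 : C) != 0. Proof. by rewrite pnatr_eq0. Qed.

Lemma psd_half (n : nat) (X : 'M[C]_n) : psd X -> psd (2^-1 *: X).
Proof. by apply: psdZ; rewrite invr_ge0 ler0n. Qed.

Lemma between_psd (n : nat) (S X : 'M[C]_n) :
  S \is hermsymmx -> between S X -> psd S.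
Proof.
move=> hS /betweenE[p q]; have := psdD p q.
rewrite addrACA subrr addr0 -mulr2n -scaler_nat => h.
by rewrite -(scale1r S) -(mulVf two_neq0) -scalerA; exact: psd_half.
Qed.

Lemma mxsqrt_herm (n : nat) (Y : 'M[C]_n) : Y \is hermsymmx ->
  psd (mxsqrt (Y ^t* *m Y)) /\
  mxsqrt (Y ^t* *m Y) *m mxsqrt (Y ^t* *m Y) = Y *m Y.
Proof.
move=> hY; have pY := psd_gram (Y ^t* ); rewrite trmxCK in pY.
have [p e] := mxsqrtP pY; split; first exact: p.
by rewrite e -(hermP _ hY).
Qed.

(** [Y] and [- Y] have the same square, so [psd_sqrt_dominates] applies to both. *)
Lemma mxsqrt_between (n : nat) (Y : 'M[C]_n) : Y \is hermsymmx ->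
  psd (mxsqrt (Y ^t* *m Y)) /\ between (mxsqrt (Y ^t* *m Y)) Y.
Proof.
move=> hY; have hN := hermN hY; have [pT e] := mxsqrt_herm hY.
split; first exact: pT.
apply/betweenE; split; last exact: psd_sqrt_dominates.
rewrite -[Y in _ + Y]opprK; apply: psd_sqrt_dominates => //.
by rewrite e mulmxN mulNmx opprK.
Qed.

(** [Y] and its absolute value are both positive with equal squares, so each dominates the other and
    the traces agree. *)
Lemma trace_norm_psd (n : nat) (Y : 'M[C]_n) :
  psd Y -> trace_norm Y = complex.Re (\tr Y).
Proof.
move=> pY; have hY := psd_herm pY.
have [pT /betweenE[_ TY]] := mxsqrt_between hY.
have [_ e] := mxsqrt_herm hY.
have YT := psd_sqrt_dominates pY (psd_herm pT) (esym e).
rewrite /trace_norm; congr (complex.Re _).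
have := psd_tr_ge0 TY; have := psd_tr_ge0 YT; rewrite !raddfB /= !subr_ge0.
by move=> h1 h2; apply: le_anti; rewrite h1 h2.
Qed.

Lemma chi1_sub_kappa (A B : finType) (rho : op R (A * B)) :
  minn #|A| #|B| = 2%N -> (chi1_values rho `<=` kappa_values rho)%classic.
Proof.
move=> hAB m [S0 [S1 [h0 h1 /betweenE[p q] /betweenE[p1 q1] ->]]].
pose N := 2^-1 *: (S1 - ptrans S0).
have pN : psd N by exact: psd_half q1.
have [M [pM tM pNM]] := qubit_dephasing hAB pN.
exists (S0 + ptrans (N + M)); split.
- exact: hermD h0 (psd_herm pNM).
- apply/betweenE; rewrite addrAC [X in _ /\ psd X]addrAC.
  by split; [exact: psdD p pNM | exact: psdD q pNM].
(* The partial transpose of the witness is [(ptrans S0 + N) + M], and its first summand is the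
   average of [S1] and [ptrans S0]. *)
- rewrite ptransD ptransK addrA; apply: (psdD _ pM).
  have -> : ptrans S0 + N = 2^-1 *: (S1 + ptrans S0).
    apply: (scalerI two_neq0); rewrite scalerDr !scalerA mulfV ?two_neq0 //.
    by rewrite !scale1r scaler_nat mulr2n -addrA [_ + (S1 - _)]addrC subrK addrC.
  exact: psd_half p1.
- rewrite mxtraceD tr_ptrans mxtraceD tM -(tr_ptrans S0).
  rewrite mxtraceZ raddfB /= -mulr2n -[_ *+ 2]mulr_natl mulrA.
  by rewrite mulfV ?two_neq0 // mul1r addrC subrK.
Qed.

Lemma kappa_sub_norm (A B : finType) (rho : op R (A * B)) :
  (kappa_values rho `<=` norm_values rho)%classic.
Proof.
move=> m [S [hS bS pS ->]]; exists S; split=> //.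
by rewrite trace_norm_psd // tr_ptrans.
Qed.

(** [S1] is the absolute value of [ptrans S0], whose trace is the trace norm. *)
Lemma norm_sub_chi1 (A B : finType) (rho : op R (A * B)) :
  (norm_values rho `<=` chi1_values rho)%classic.
Proof.
move=> m [S0 [h0 b0 ->]]; have [pT bT] := mxsqrt_between (herm_ptrans h0).
by exists S0, (mxsqrt ((ptrans S0) ^t* *m ptrans S0)); split=> //; case: pT.
Qed.

(** The absolute value of [ptrans rho] is feasible. Equality of the sets of values later carries
    this over to [kappa_values]. *)
Lemma norm_values_nonempty (A B : finType) (rho : op R (A * B)) :
  rho \is hermsymmx -> (norm_values rho !=set0)%classic.
Proof.
move=> hr; have [pT bT] := mxsqrt_between (herm_ptrans hr).
by exists (trace_norm (ptrans (mxsqrt ((ptrans rho) ^t* *m ptrans rho)))),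
  (mxsqrt ((ptrans rho) ^t* *m ptrans rho)); split=> //; case: pT.
Qed.

End Values.

(** * Real coordinates and attained minima *)

Section Coordinates.
Context {R : realType}.
Local Notation C := R[i].
Opaque psd.

(** On Hermitian matrices this is the real Hilbert-Schmidt inner product. *)
Definition rdot (n : nat) (X Y : 'M[C]_n) : R := complex.Re (\tr (X *m Y)).

Lemma ReD (x y : C) : complex.Re (x + y) = complex.Re x + complex.Re y.
Proof. exact: raddfD. Qed.

Lemma ReN (x : C) : complex.Re (- x) = - complex.Re x.
Proof. exact: raddfN. Qed.

Lemma ReZ (a : R) (x : C) : complex.Re (real_complex R a * x) = a * complex.Re x.
Proof. by case: x => x y /=; rewrite mul0r subr0. Qed.

Lemma Re_sum (I : Type) (r : seq I) (P : pred I) (F : I -> C) :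
  complex.Re (\sum_(k <- r | P k) F k) = \sum_(k <- r | P k) complex.Re (F k).
Proof. exact: raddf_sum. Qed.

Lemma Re_ge0 (x : C) : 0 <= x -> 0 <= complex.Re x.
Proof. by rewrite lecE => /andP[]. Qed.

Lemma Re_le (x y : C) : x <= y -> complex.Re x <= complex.Re y.
Proof. by rewrite lecE => /andP[]. Qed.

Lemma conj_fixedE (x : C) : x^* = x -> x = real_complex R (complex.Re x).
Proof. by move=> h; rewrite RRe_real //; apply/CrealP. Qed.

Lemma rdotC (n : nat) (X Y : 'M[C]_n) : rdot X Y = rdot Y X.
Proof. by rewrite /rdot mxtrace_mulC. Qed.

Lemma rdotDl (n : nat) (X Y Z : 'M[C]_n) : rdot (X + Y) Z = rdot X Z + rdot Y Z.
Proof. by rewrite /rdot mulmxDl mxtraceD ReD. Qed.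

Lemma rdotNl (n : nat) (X Z : 'M[C]_n) : rdot (- X) Z = - rdot X Z.
Proof. by rewrite /rdot mulNmx raddfN /= ReN. Qed.

Lemma rdotZl (n : nat) (a : R) (X Z : 'M[C]_n) :
  rdot (real_complex R a *: X) Z = a * rdot X Z.
Proof. by rewrite /rdot -scalemxAl mxtraceZ ReZ. Qed.

Lemma rdotBl (n : nat) (X Y Z : 'M[C]_n) : rdot (X - Y) Z = rdot X Z - rdot Y Z.
Proof. by rewrite rdotDl rdotNl. Qed.

Lemma rdotDr (n : nat) (X Y Z : 'M[C]_n) : rdot Z (X + Y) = rdot Z X + rdot Z Y.
Proof. by rewrite ![rdot Z _]rdotC rdotDl. Qed.

Lemma rdotBr (n : nat) (X Y Z : 'M[C]_n) : rdot Z (X - Y) = rdot Z X - rdot Z Y.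
Proof. by rewrite ![rdot Z _]rdotC rdotBl. Qed.

Lemma rdotZr (n : nat) (a : R) (X Z : 'M[C]_n) :
  rdot Z (real_complex R a *: X) = a * rdot Z X.
Proof. by rewrite ![rdot Z _]rdotC rdotZl. Qed.

Lemma rdot1 (n : nat) (X : 'M[C]_n) : rdot X 1%:M = complex.Re (\tr X).
Proof. by rewrite /rdot mulmx1. Qed.

Lemma rdot_psd (n : nat) (X Y : 'M[C]_n) : psd X -> psd Y -> 0 <= rdot X Y.
Proof. by move=> pX pY; apply/Re_ge0/psd_trM_ge0. Qed.

Lemma herm_trM_real (n : nat) (X Y : 'M[C]_n) :
  X \is hermsymmx -> Y \is hermsymmx -> (\tr (X *m Y))^* = \tr (X *m Y).
Proof.
move=> /hermP hX /hermP hY.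
have <- : \tr ((X *m Y) ^t* ) = (\tr (X *m Y))^*.
  by rewrite /mxtrace rmorph_sum; apply: eq_bigr => k _; rewrite !mxE.
by rewrite adjmxM -hX -hY mxtrace_mulC.
Qed.

Lemma psd_rdot (n : nat) (X : 'M[C]_n) : X \is hermsymmx ->
  (forall Y, psd Y -> 0 <= rdot X Y) -> psd X.
Proof.
move=> hX pX; apply: psd_dual => // Y pY.
by rewrite (conj_fixedE (herm_trM_real hX (psd_herm pY))) ler0c; exact: pX.
Qed.

Lemma rdot_sqr (n : nat) (X : 'M[C]_n) : X \is hermsymmx ->
  rdot X X = \sum_i \sum_j (complex.Re (X i j) ^+ 2 + complex.Im (X i j) ^+ 2).
Proof.
move=> hX; rewrite /rdot {2}(hermP _ hX) /mxtrace Re_sum.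
apply: eq_bigr => i _; rewrite mxE Re_sum; apply: eq_bigr => j _.
by rewrite !mxE; case: (X i j) => a b /=; ring.
Qed.

(** Each [X i j] is an inner product of two rows of a root [Y], and [|a b| <= |a|^2 + |b|^2] bounds
    it by [X i i + X j j]. This turns a bound on the trace into compactness. *)
Lemma psd_entry_bound (n : nat) (X : 'M[C]_n) i j :
  psd X -> `|X i j| <= 2 * \tr X.
Proof.
move=> pX; have [Y XY] := psd_root pX.
have dE k : X k k = \sum_l `|Y k l| ^+ 2.
  by rewrite XY mxE; apply: eq_bigr => l _; rewrite !mxE -normCK.
have d0 k : 0 <= X k k by rewrite dE; apply: sumr_ge0 => l _; exact: exprn_ge0.
have dT k : X k k <= \tr X.
  by rewrite /mxtrace (bigD1 k) //= lerDl; apply: sumr_ge0 => l _; exact: d0.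
have -> : 2 * \tr X = \tr X + \tr X by rewrite mulr_natl mulr2n.
apply: le_trans (lerD (dT i) (dT j)).
rewrite !dE -big_split /= XY mxE.
apply: le_trans (ler_norm_sum _ _ _) _; apply: ler_sum => l _.
rewrite !mxE normrM norm_conjC -subr_ge0.
have -> : `|Y i l| ^+ 2 + `|Y j l| ^+ 2 - `|Y i l| * `|Y j l| =
   (`|Y i l| - `|Y j l|) ^+ 2 + `|Y i l| * `|Y j l| by ring.
apply: addr_ge0; last exact: mulr_ge0.
by apply: real_exprn_even_ge0 => //; apply: rpredB; exact: normr_real.
Qed.

(* Real coordinates on Hermitian matrices: [M + M^T] is the real part and
   [M - M^T] the imaginary part. *)
Definition hm (n : nat) (u : 'rV[R]_(n * n)) : 'M[C]_n :=
  let M := vec_mx u in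
  \matrix_(i, j) Complex (M i j + M j i) (M i j - M j i).

Lemma hm_herm (n : nat) (u : 'rV[R]_(n * n)) : hm u \is hermsymmx.
Proof.
rewrite /hm; move: (vec_mx u) => M.
apply/hermP/matrixP => i j; rewrite !mxE.
transitivity (conjc (Complex (M j i + M i j) (M j i - M i j))) => /=.
  by congr Complex; [rewrite addrC | rewrite opprB].
by [].
Qed.

Lemma hm_surj (n : nat) (X : 'M[C]_n) : X \is hermsymmx -> exists u, X = hm u.
Proof.
move=> /hermP hX.
(* The real part of [X] is symmetric and its imaginary part antisymmetric, so half their sum [M] has
   [M + M^T] and [M - M^T] equal to these two parts. *)
exists (mxvec (\matrix_(i, j) ((complex.Re (X i j) + complex.Im (X i j)) / 2))).
apply/matrixP => i j; rewrite /hm mxvecK !mxE.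
have -> : X j i = conjc (X i j) by rewrite {1}hX !mxE.
by case: (X i j) => a b /=; congr Complex; field.
Qed.

Lemma hm_linear (n : nat) a (u v : 'rV[R]_(n * n)) :
  hm (a *: u + v) = real_complex R a *: hm u + hm v.
Proof.
apply/matrixP => i j; rewrite !mxE.
move: (u _ _) (u _ _) (v _ _) (v _ _) => p q r s.
by apply/eqP; rewrite eq_complex /= !mul0r subr0 addr0; apply/andP; split;
  apply/eqP; ring.
Qed.

Lemma hm_coord (n : nat) (u : 'rV[R]_(n * n)) i j :
  u 0 (mxvec_index i j) =
    (complex.Re (hm u i j) + complex.Im (hm u i j)) / 2.
Proof. by rewrite !mxE /=; field. Qed.

Lemma hm_bound (n : nat) (u : 'rV[R]_(n * n)) k : psd (hm u) ->
  `|u 0 k| <= 2 * complex.Re (\tr (hm u)).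
Proof.
move=> pu; case/mxvec_indexP: k => i j; rewrite hm_coord.
have := Re_le (psd_entry_bound i j pu).
have -> : 2 * \tr (hm u) = real_complex R 2 * \tr (hm u) by rewrite rmorph_nat.
rewrite ReZ => le_tr.
have [leRe leIm] : `|complex.Re (hm u i j)| <= complex.Re `|hm u i j| /\
    `|complex.Im (hm u i j)| <= complex.Re `|hm u i j|.
  rewrite normc_def; case: (hm u i j) => a b /=.
  by split; rewrite -sqrtr_sqr ler_wsqrtr // ?lerDl ?lerDr sqr_ge0.
rewrite normrM [`|2^-1|]ger0_norm ?invr_ge0 ?ler0n //.
rewrite ler_pdivrMr ?ltr0n //; apply: le_trans (ler_normD _ _) _.
by lra.
Qed.

Lemma continuous_bigsum (T : topologicalType) (I : finType) (f : I -> T -> R) :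
  (forall k, continuous (f k)) -> continuous (fun t => \sum_k f k t).
Proof.
move=> cf; elim: (index_enum _) => [|j r IH].
  by under eq_fun do rewrite big_nil; exact: cst_continuous.
under eq_fun do rewrite big_cons.
by move=> u; exact: (continuousD (cf j u) (IH u)).
Qed.

Lemma linear_rV_continuous (N : nat) (f : 'rV[R]_N -> R) :
  (forall a u v, f (a *: u + v) = a * f u + f v) -> continuous f.
Proof.
move=> fl.
have f0 : f 0 = 0.
  have := fl 1 0 0; rewrite scaler0 addr0 mul1r => /eqP.
  by rewrite -subr_eq0 opprD addrA subrr sub0r oppr_eq0 => /eqP.
have fE u (r : seq 'I_N) : f (\sum_(j <- r) u 0 j *: delta_mx 0 j) =
    \sum_(j <- r) u 0 j * f (delta_mx 0 j).
  by elim: r => [|j r IH]; rewrite ?big_nil // !big_cons fl IH.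
have -> : f = fun u => \sum_j u 0 j * f (delta_mx 0 j).
  by apply/funext => u; rewrite {1}[u]row_sum_delta fE.
apply: continuous_bigsum => j.
have c0 := @coord_continuous R 1 N 0 j.
by move=> u; exact: (cvgMr_tmp (c0 u)).
Qed.

(** The sublevel set of [u0] inside [A] is closed and lies in a box, hence is compact; a minimum
    there is a minimum on all of [A]. *)
Lemma rV_minimum (N : nat) (A : set 'rV[R]_N) (F : 'rV[R]_N -> R) u0 M :
  closed A -> continuous F -> A u0 ->
  (forall u, A u -> F u <= F u0 -> forall k, `|u 0 k| <= M) ->
  exists2 c, A c & forall u, A u -> F c <= F u.
Proof.
move=> clA cF Au0 bd.
pose K := (A `&` [set u | F u <= F u0])%classic.
have cK : compact K.
  have cbox : compact [set u : 'rV[R]_N | forall k, `[(- M), M]%classic (u ord0 k)].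
    apply: (@rV_compact _ _ (fun=> `[(- M), M]%classic)) => _.
    exact: segment_compact.
  apply: subclosed_compact cbox _.
    apply: closedI => //.
    by apply: (preimage_closed _ (@closed_le _ (F u0))) => u _; exact: cF.
  move=> u [Au Fu] k /=; rewrite in_itv /= -ler_norml; exact: bd.
have [|c /set_mem[Ac Fc] mc] := compact_EVT_min _ cK (continuous_subspaceT cF).
  by exists u0; split=> //=.
exists c => // u Au; have [Fu|/ltW Fu] := leP (F u) (F u0).
  by apply: mc; apply/mem_set.
exact: le_trans Fc Fu.
Qed.

End Coordinates.

(** * Attainment of the minimum in the program of [E_kappa] *)

Section Minima.
Context {R : realType}.
Local Notation C := R[i].
Opaque psd hm ptrans.

(** The scalars are real because the Hermitian matrices, parametrised by [hm], form only a real
    vector space. *)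
Definition rlin (N n : nat) (L : 'rV[R]_N -> 'M[C]_n) :=
  forall a u v, L (a *: u + v) = real_complex R a *: L u + L v.

Lemma rlinD (N n : nat) (L L' : 'rV[R]_N -> 'M[C]_n) :
  rlin L -> rlin L' -> rlin (fun u => L u + L' u).
Proof. by move=> l l' a u v; rewrite l l' scalerDr addrACA. Qed.

Lemma rlinN (N n : nat) (L : 'rV[R]_N -> 'M[C]_n) :
  rlin L -> rlin (fun u => - L u).
Proof. by move=> l a u v; rewrite l scalerN opprD. Qed.

Lemma rlin_ptrans (N : nat) (I J : finType) (L : 'rV[R]_N -> op R (I * J)) :
  rlin L -> rlin (fun u => ptrans (L u)).
Proof. by move=> l a u v; rewrite l ptransD ptransZ. Qed.

Lemma rlin_rdot_continuous (N n : nat) (L : 'rV[R]_N -> 'M[C]_n) Y :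
  rlin L -> continuous (fun u => rdot (L u) Y).
Proof.
by move=> l; apply: linear_rV_continuous => a u v; rewrite l rdotDl rdotZl.
Qed.

Lemma rlin_sqr_continuous (N n : nat) (L : 'rV[R]_N -> 'M[C]_n) :
  rlin L -> continuous (fun u => rdot (L u) (L u)).
Proof.
move=> l.
have cRe i j : continuous (fun u => complex.Re (L u i j)).
  by apply: linear_rV_continuous => a u v; rewrite l !mxE ReD ReZ.
have cIm i j : continuous (fun u => complex.Im (L u i j)).
  apply: linear_rV_continuous => a u v; rewrite l !mxE.
  by case: (L u i j) (L v i j) => [p q] [r s] /=; rewrite mul0r addr0.
have -> : (fun u => rdot (L u) (L u)) = fun u => \sum_i \sum_j
    (complex.Re (L u i j) * complex.Re (L u j i)
     - complex.Im (L u i j) * complex.Im (L u j i)).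
  apply/funext => u; rewrite /rdot /mxtrace Re_sum; apply: eq_bigr => i _.
  rewrite mxE Re_sum; apply: eq_bigr => j _.
  by case: (L u i j) (L u j i) => [p q] [r s].
apply: continuous_bigsum => i; apply: continuous_bigsum => j u.
by apply: (continuousB (continuousM (cRe i j u) (cRe j i u))
  (continuousM (cIm i j u) (cIm j i u))).
Qed.

Opaque rdot.

(** By [psd_rdot] the positive cone is, among Hermitian matrices, an intersection of half-spaces,
    and each of them pulls back to a closed set. *)
Lemma closed_psd (N n : nat) (L : 'rV[R]_N -> 'M[C]_n) (K : 'M[C]_n) :
  rlin L -> (forall u, L u + K \is hermsymmx) ->
  closed [set u | psd (L u + K)].
Proof.
move=> l h.
have -> : [set u | psd (L u + K)]%classic =
    (\bigcap_(Y in [set Y | psd Y])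
      ((fun u => rdot (L u) Y) @^-1` [set x | - rdot K Y <= x]))%classic.
  apply/seteqP; split=> u /= pu.
    by move=> Y /= pY; rewrite -subr_ge0 opprK -rdotDl; exact: rdot_psd.
  apply: psd_rdot => // Y pY; have := pu Y pY; rewrite /=.
  by rewrite -subr_ge0 opprK -rdotDl.
apply: closed_bigI => Y _.
by apply: (preimage_closed _ (@closed_ge _ _)) => u _; exact: rlin_rdot_continuous.
Qed.

Lemma kappa_minimum (A B : finType) (rho : op R (A * B)) :
  rho \is hermsymmx -> (kappa_values rho !=set0)%classic ->
  has_minimum (kappa_values rho).
Proof.
move=> hr [m0 [S0 [h0 /betweenE[p0 q0] k0 m0E]]]; have hH := herm_ptrans hr.
have [u0 e0] := hm_surj h0; rewrite {}e0 in p0 q0 k0.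
move: hH p0 q0 k0; set H := ptrans rho => hH p0 q0 k0.
pose K := ([set u | psd (hm u + H)] `&` [set u | psd (hm u + - H)]
  `&` [set u | psd (ptrans (hm u) + 0)])%classic.
have lX : rlin (@hm R #|{: A * B}|) by exact: hm_linear.
have hX u : @hm R #|{: A * B}| u \is hermsymmx by exact: hm_herm.
have hX0 u : (ptrans (hm u) + 0 : op R (A * B)) \is hermsymmx.
  by rewrite addr0; exact: herm_ptrans (hX u).
have clK : closed K.
  apply: closedI; first apply: closedI.
  - exact: closed_psd lX (fun u => hermD (hX u) hH).
  - exact: closed_psd lX (fun u => hermB (hX u) hH).
  - exact: closed_psd (rlin_ptrans lX) hX0.
have Ku0 : K u0.
  by split; [split; [exact: p0 | exact: q0] | rewrite /= addr0; exact: k0].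
(* The two-sided constraint forces [hm u] to be positive, so the objective, its trace, bounds all
   coordinates. *)
have bdK u : K u -> rdot (hm u) 1%:M <= rdot (hm u0) 1%:M ->
    forall k, `|u 0 k| <= 2 * rdot (hm u0) 1%:M.
  move=> [[/= u1 u2] _] le_u k.
  have pu : psd (hm u).
    exact: (between_psd (hX u) (proj2 (betweenE _ _) (conj u1 u2))).
  apply: le_trans (hm_bound k pu) _; rewrite -rdot1.
  by rewrite ler_pM2l // ltr0n.
have [c [[/= c1 c2] c3] mc] :=
  rV_minimum clK (rlin_rdot_continuous (Y := 1%:M) lX) Ku0 bdK.
rewrite /= addr0 in c3.
exists (rdot (hm c) 1%:M).
  exists (hm c); split; [exact: hX| |exact: c3|exact: rdot1].
  exact: (proj2 (betweenE _ _) (conj c1 c2)).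
move=> m [S [hS /betweenE[p q] k ->]]; have [u eu] := hm_surj hS.
rewrite eu in p q k *; rewrite -rdot1; apply: mc.
by split; [split; [exact: p | exact: q] | rewrite /= addr0; exact: k].
Qed.

End Minima.

(** * The closest point of a convex cone *)

Section Penalty.
Context {R : realType}.
Local Notation C := R[i].
Opaque psd hm ptrans rdot.

(* The squared distance from [(1, b)] to the convex cone of all
   [(P + Q + ptrans Z, rdot H (P - Q))] is attained. *)
Definition penalty (A B : finType) (H : op R (A * B)) (b : R)
    (P Q Z : op R (A * B)) : R :=
  rdot (P + Q + ptrans Z - 1%:M) (P + Q + ptrans Z - 1%:M)
    + (rdot (P - Q) H - b) ^+ 2.

Lemma le_sum3 (x y z m : R) : 0 <= x -> 0 <= y -> 0 <= z -> x + y + z <= m ->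
  [/\ x <= m, y <= m & z <= m].
Proof. by move=> *; split; lra. Qed.

Lemma hm0 (n : nat) : hm (0 : 'rV[R]_(n * n)) = 0.
Proof.
have := @hm_linear R n 1 0 0; rewrite scaler0 addr0 scale1r => /eqP.
by rewrite -subr_eq0 opprD addrA subrr sub0r oppr_eq0 => /eqP.
Qed.

(** The minimum is taken over the generators [P], [Q], [Z] rather than over points of the cone.
    Their sublevel sets are bounded, since [P + Q + ptrans Z] has as trace the sum of three
    non-negative traces. *)
Lemma penalty_minimum (A B : finType) (H : op R (A * B)) (b : R) :
  exists P Q Z : op R (A * B), [/\ psd P, psd Q, psd Z &
    forall P' Q' Z', psd P' -> psd Q' -> psd Z' ->
      penalty H b P Q Z <= penalty H b P' Q' Z'].
Proof.
pose n := #|{: A * B}|; pose N := (n * n)%N.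
pose fP (u : 'rV[R]_(N + (N + N))) : 'rV[R]_N := lsubmx u.
pose fQ (u : 'rV[R]_(N + (N + N))) : 'rV[R]_N := lsubmx (rsubmx u).
pose fZ (u : 'rV[R]_(N + (N + N))) : 'rV[R]_N := rsubmx (rsubmx u).
pose P u : op R (A * B) := hm (fP u).
pose Q u : op R (A * B) := hm (fQ u).
pose Z u : op R (A * B) := hm (fZ u).
have lP : rlin P by move=> a u v; rewrite /P /fP linearP hm_linear.
have lQ : rlin Q by move=> a u v; rewrite /Q /fQ !linearP hm_linear.
have lZ : rlin Z by move=> a u v; rewrite /Z /fZ !linearP hm_linear.
pose L u := P u + Q u + ptrans (Z u).
have lL : rlin L := rlinD (rlinD lP lQ) (rlin_ptrans lZ).
have lD : rlin (fun u => P u - Q u) := rlinD lP (rlinN lQ).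
pose F u := penalty H b (P u) (Q u) (Z u).
have cF : continuous F.
  have -> : F = fun u => (rdot (L u) (L u) + (- 2 * rdot (L u) 1%:M)
      + rdot (1%:M : op R (A * B)) 1%:M) + (rdot (P u - Q u) H - b) ^+ 2.
    apply/funext => u; rewrite /F /penalty -/(L u); congr (_ + _).
    rewrite rdotBl !rdotBr [rdot 1%:M (L u)]rdotC.
    move: (rdot (L u) (L u)) (rdot (L u) 1%:M) (rdot (1%:M : op R (A * B)) 1%:M).
    by move=> x y z; ring.
  have c1 := rlin_sqr_continuous lL.
  have c2 := rlin_rdot_continuous (Y := 1%:M) lL.
  have c3 := rlin_rdot_continuous (Y := H) lD.
  have c4 : continuous (fun u => rdot (P u - Q u) H - b).
    by move=> u; exact: (cvgB (c3 u) (cvg_cst b)).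
  have c5 : continuous (fun u => - 2 * rdot (L u) 1%:M).
    by move=> u; exact: (cvgMl_tmp (c2 u)).
  have c6 : continuous (fun u => rdot (L u) (L u) + (- 2 * rdot (L u) 1%:M)).
    by move=> u; exact: (continuousD (c1 u) (c5 u)).
  have c7 : continuous (fun u => (rdot (P u - Q u) H - b) ^+ 2).
    by move=> u; exact: (cvgM (c4 u) (c4 u)).
  have c8 : continuous (fun u => rdot (L u) (L u) + (- 2 * rdot (L u) 1%:M)
      + rdot (1%:M : op R (A * B)) 1%:M).
    by move=> u; exact: (cvgD (c6 u) (cvg_cst _)).
  by move=> u; exact: (continuousD (c8 u) (c7 u)).
pose K := ([set u | psd (P u + 0)] `&` [set u | psd (Q u + 0)]
  `&` [set u | psd (Z u + 0)])%classic.
have hm_h u : (hm u + 0 : 'M[C]_n) \is hermsymmx.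
  by rewrite addr0; exact: hm_herm.
have clK : closed K.
  apply: closedI; first apply: closedI.
  - exact: closed_psd lP (fun u => hm_h (fP u)).
  - exact: closed_psd lQ (fun u => hm_h (fQ u)).
  - exact: closed_psd lZ (fun u => hm_h (fZ u)).
have psd00 : psd (hm (0 : 'rV[R]_N) + 0 : op R (A * B)).
  by rewrite hm0 addr0; exact: psd0.
have K0 : K 0.
  by split; [split|]; rewrite /= /P /Q /Z /fP /fQ /fZ !linear0; exact: psd00.
(* With [d = rdot 1 1], the inequality [|L u - 2|^2 >= 0] gives [|L u - 1|^2 >= 2 Tr (L u) - 3 d].
   Hence [F u <= F 0] forces [Tr (L u) <= M / 2], and [hm_bound] costs a factor [2]. *)
pose M := F 0 + 3 * rdot (1%:M : op R (A * B)) 1%:M.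
have bdK u : K u -> F u <= F 0 -> forall k, `|u 0 k| <= M.
  move=> [[/= pP pQ] pZ] leF k; rewrite !addr0 in pP pQ pZ.
  have tP : 0 <= rdot (P u) 1%:M by exact: rdot_psd pP (psd1 _).
  have tQ : 0 <= rdot (Q u) 1%:M by exact: rdot_psd pQ (psd1 _).
  have tZ : 0 <= rdot (Z u) 1%:M by exact: rdot_psd pZ (psd1 _).
  have t1 : 0 <= rdot (1%:M : op R (A * B)) 1%:M by exact: rdot_psd (psd1 _) (psd1 _).
  have tL : rdot (L u) 1%:M = rdot (P u) 1%:M + rdot (Q u) 1%:M + rdot (Z u) 1%:M.
    by rewrite /L !rdotDl !rdot1 tr_ptrans.
  have hL : L u - 1%:M - 1%:M \is hermsymmx.
    apply: hermB (psd_herm (psd1 _)); apply: hermB (psd_herm (psd1 _)).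
    exact: hermD (hermD (psd_herm pP) (psd_herm pQ)) (herm_ptrans (psd_herm pZ)).
  have sq : 0 <= rdot (L u - 1%:M - 1%:M) (L u - 1%:M - 1%:M).
    rewrite (rdot_sqr hL); apply: sumr_ge0 => i _; apply: sumr_ge0 => j _.
    by rewrite addr_ge0 ?sqr_ge0.
  have sq2 : 0 <= (rdot (P u - Q u) H - b) ^+ 2 by exact: sqr_ge0.
  have le_t : rdot (P u) 1%:M + rdot (Q u) 1%:M + rdot (Z u) 1%:M <= M / 2.
    rewrite -tL; move: leF sq2; rewrite {1}/F /penalty -/(L u) /M.
    move: (_ ^+ 2) (F 0) => s f.
    move: sq t1; rewrite !rdotBl !rdotBr [rdot 1%:M (L u)]rdotC.
    move: (rdot (L u) (L u)) (rdot (L u) 1%:M) (rdot _ _) => x y z.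
    by clear; lra.
  have bound (w : 'rV[R]_N) (l : 'I_N) : psd (hm w : op R (A * B)) ->
      rdot (hm w : op R (A * B)) 1%:M <= M / 2 -> `|w 0 l| <= M.
    move=> pw; rewrite rdot1 => lew; apply: le_trans (hm_bound l pw) _.
    by rewrite mulrC -ler_pdivlMr // ltr0n.
  have [leP leQ leZ] := le_sum3 tP tQ tZ le_t.
  case: (split_ordP k) => l ->.
    by have := bound (fP u) l pP leP; rewrite mxE.
  case: (split_ordP l) => l' ->.
    by have := bound (fQ u) l' pQ leQ; rewrite !mxE.
  by have := bound (fZ u) l' pZ leZ; rewrite !mxE.
have [c [[/= pP pQ] pZ] mc] := rV_minimum clK cF K0 bdK.
rewrite !addr0 in pP pQ pZ.
exists (P c), (Q c), (Z c); split; [exact: pP|exact: pQ|exact: pZ|].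
move=> P' Q' Z' pP' pQ' pZ'.
have [p eP] := hm_surj (psd_herm pP').
have [q eQ] := hm_surj (psd_herm pQ').
have [z eZ] := hm_surj (psd_herm pZ').
have := mc (row_mx p (row_mx q z)).
rewrite /F /K /P /Q /Z /fP /fQ /fZ /= !row_mxKr !row_mxKl -eP -eQ -eZ !addr0.
by apply; split; [split; [exact: pP'|exact: pQ']|exact: pZ'].
Qed.

End Penalty.

(** * Strong duality *)

Section Duality.
Context {R : realType}.
Local Notation C := R[i].
Opaque psd hm ptrans.

(** First-order condition at a minimum: for small [t] the linear term decides the sign. The range
    stops at [1] so that scaling by [1 - t] keeps matrices positive. *)
Lemma quad_ge0 (a c : R) :
  (forall t, 0 < t -> t <= 1 -> 0 <= 2 * t * a + t ^+ 2 * c) -> 0 <= a.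
Proof.
move=> h; rewrite leNgt; apply/negP => a0.
have c1 : 0 <= `|c| by exact: normr_ge0.
have d0 : 0 < `|c| - a by lra.
(* This choice makes [t * |c| <= - a], so the quadratic is at most [t * a < 0]. *)
pose t := - a / (`|c| - a).
have t0 : 0 < t by apply: divr_gt0 => //; lra.
have t1 : t <= 1 by rewrite ler_pdivrMr // mul1r; lra.
have e : t * (`|c| - a) = - a by rewrite /t -mulrA mulVf ?mulr1 // gt_eqF.
have tc : t * `|c| <= - a by rewrite -e ler_pM2l //; lra.
have le_c : t ^+ 2 * c <= t * (- a).
  rewrite expr2 -mulrA ler_pM2l //; apply: le_trans tc.
  by rewrite ler_pM2l // ler_norm.
have := h t t0 t1; have ta : t * a < 0 by rewrite pmulr_rlt0.
have -> : 2 * t * a = t * a + t * a by ring.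
by rewrite mulrN in le_c; lra.
Qed.

Lemma ptrans0 (I J : finType) : ptrans (0 : op R (I * J)) = 0.
Proof. by rewrite -(scale0r 0) ptransZ !scale0r. Qed.

Lemma rdot0l (n : nat) (X : 'M[C]_n) : rdot 0 X = 0.
Proof. by rewrite -(subrr X) rdotBl subrr. Qed.

Lemma rdot_ptransl (I J : finType) (X Y : op R (I * J)) :
  rdot (ptrans X) Y = rdot X (ptrans Y).
Proof. by rewrite /rdot tr_ptransMl. Qed.

Opaque rdot.

Lemma penalty_expand (A B : finType) (H P Q Z P' Q' Z' : op R (A * B)) (b t : R) :
  let s := real_complex R t in
  penalty H b (P + s *: P') (Q + s *: Q') (Z + s *: Z') =
  penalty H b P Q Z
    + (2 * t * (rdot (P + Q + ptrans Z - 1%:M) (P' + Q' + ptrans Z')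
                + (rdot (P - Q) H - b) * rdot (P' - Q') H)
       + t ^+ 2 * (rdot (P' + Q' + ptrans Z') (P' + Q' + ptrans Z')
                   + rdot (P' - Q') H ^+ 2)).
Proof.
move=> s; rewrite /penalty ptransD ptransZ.
set D := P + Q + ptrans Z - 1%:M; set W := P' + Q' + ptrans Z'.
have -> : P + s *: P' + (Q + s *: Q') + (ptrans Z + s *: ptrans Z') - 1%:M =
    D + s *: W.
  rewrite /D /W !scalerDr; move: (s *: P') (s *: Q') (s *: ptrans Z').
  by move=> p q z; rewrite (addrACA P) (addrACA (P + Q)) [LHS]addrAC.
have -> : P + s *: P' - (Q + s *: Q') = (P - Q) + s *: (P' - Q').
  by rewrite scalerBr opprD addrACA.
clearbody D W; rewrite (rdotDl (P - Q)) (rdotZl _ (P' - Q')).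
move: (P - Q) (P' - Q') => E E'.
rewrite !rdotDl !rdotDr !rdotZl !rdotZr [rdot W D]rdotC.
move: (rdot D D) (rdot D W) (rdot W W) (rdot E H) (rdot E' H).
by move=> x y z v w; ring.
Qed.

(* If the residual [(D, u)] at the closest point of the cone were not zero,
   then [- D / u] would be a feasible [S] of trace less than [b]. *)
Lemma sdp_duality (A B : finType) (H : op R (A * B)) (b : R) :
  H \is hermsymmx -> 0 <= b ->
  (forall S : op R (A * B), S \is hermsymmx -> between S H -> psd (ptrans S) ->
     b <= complex.Re (\tr S)) ->
  exists P Q : op R (A * B),
    [/\ psd P, psd Q, psd (1%:M - ptrans (P + Q)) & rdot (P - Q) H = b].
Proof.
move=> hH b0 lb; have [P [Q [Z [pP pQ pZ mn]]]] := penalty_minimum H b.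
set D := P + Q + ptrans Z - 1%:M; set u := rdot (P - Q) H - b.
have hD : D \is hermsymmx.
  apply: hermB (psd_herm (psd1 _)).
  exact: hermD (hermD (psd_herm pP) (psd_herm pQ)) (herm_ptrans (psd_herm pZ)).
(* Adding a small multiple of a cone element stays in the cone, so the squared distance has a
   non-negative derivative in that direction. *)
have var P' Q' Z' : psd P' -> psd Q' -> psd Z' ->
    0 <= rdot D (P' + Q' + ptrans Z') + u * rdot (P' - Q') H.
  move=> pP' pQ' pZ'; apply: (quad_ge0 (c := rdot (P' + Q' + ptrans Z')
    (P' + Q' + ptrans Z') + rdot (P' - Q') H ^+ 2)) => t t0 _.
  have s0 : 0 <= real_complex R t by rewrite ler0c ltW.
  have := mn _ _ _ (psdD pP (psdZ s0 pP')) (psdD pQ (psdZ s0 pQ'))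
    (psdD pZ (psdZ s0 pZ')).
  by rewrite penalty_expand lerDl.
(* Shrinking the closest point by [1 - t] also stays in the cone. This gives the opposite inequality
   along the point itself, which is [(D + 1, u + b)]. *)
have stat : rdot D D + rdot D 1%:M + u ^+ 2 + u * b <= 0.
  have eD : P + Q + ptrans Z = D + 1%:M by rewrite /D subrK.
  have eu : rdot (P - Q) H = u + b by rewrite /u subrK.
  have : 0 <= - (rdot D (P + Q + ptrans Z) + u * rdot (P - Q) H).
    apply: (quad_ge0 (c := rdot (P + Q + ptrans Z) (P + Q + ptrans Z)
      + rdot (P - Q) H ^+ 2)) => t t0 t1.
    have s0 : 0 <= real_complex R (1 - t) by rewrite ler0c subr_ge0.
    have := mn _ _ _ (psdZ s0 pP) (psdZ s0 pQ) (psdZ s0 pZ).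
    have sE (X : op R (A * B)) : real_complex R (1 - t) *: X =
        X + real_complex R (- t) *: X.
      by rewrite rmorphD rmorph1 scalerDl scale1r.
    rewrite !sE penalty_expand lerDl -/D -/u.
    by rewrite sqrrN mulrN mulNr -mulrN.
  rewrite eD eu rdotDr; move: (rdot D D) (rdot D 1%:M) => x y.
  rewrite oppr_ge0 mulrDr -expr2; move: (u ^+ 2) (u * b) => z v.
  by clear; rewrite !addrA.
have hZ : (real_complex R u *: H) \is hermsymmx.
  by apply: hermZ hH; apply/complex_realP; exists u.
have z0 := psd0 (R := R) #|{: A * B}|.
(* Testing [var] on one generator at a time yields the three constraints that make a positive
   multiple of [D] feasible. *)
have pDp : psd (D + real_complex R u *: H).
  apply: (psd_rdot (hermD hD hZ)) => Y pY; have := var Y 0 0 pY z0 z0.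
  by rewrite ptrans0 subr0 !addr0 rdotDl rdotZl [rdot H Y]rdotC.
have pDm : psd (D - real_complex R u *: H).
  apply: (psd_rdot (hermB hD hZ)) => Y pY; have := var 0 Y 0 z0 pY z0.
  by rewrite ptrans0 sub0r addr0 add0r rdotNl mulrN rdotBl rdotZl [rdot H Y]rdotC.
have pDt : psd (ptrans D).
  apply: (psd_rdot (herm_ptrans hD)) => Y pY; have := var 0 0 Y z0 z0 pY.
  by rewrite subrr addr0 add0r rdot0l mulr0 addr0 rdot_ptransl.
have pD : psd D.
  by apply: (between_psd hD); apply/betweenE; split; [exact: pDp|exact: pDm].
have DD0 : 0 <= rdot D D by exact: (rdot_psd pD pD).
have D1 : 0 <= rdot D 1%:M by exact: rdot_psd pD (psd1 _).
have uu0 : 0 <= u ^+ 2 by exact: sqr_ge0.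
(* If [u = 0], then [stat] forces [D = 0], and [P], [Q] are the dual solution with slack [Z]. If
   [u < 0], the feasible [- D / u] and the bound [b] contradict [stat]. If [u > 0], then [0 <= b]
   contradicts [stat]. *)
have [u0|u0|u0] := ltgtP u 0; last 1 first.
- have D0 : D = 0.
    apply/matrixP => i j; rewrite [RHS]mxE; apply/eqP.
    have /eqP : rdot D D = 0 by move: stat; rewrite u0 mul0r; clear -DD0 D1; lra.
    rewrite (rdot_sqr hD) psumr_eq0 => [/allP /(_ i (mem_index_enum _))|k _]; last first.
      by apply: sumr_ge0 => l _; rewrite addr_ge0 ?sqr_ge0.
    rewrite /= psumr_eq0 => [/allP /(_ j (mem_index_enum _))|l _]; last first.
      by rewrite addr_ge0 ?sqr_ge0.
    by rewrite /= paddr_eq0 ?sqr_ge0 // !sqrf_eq0 eq_complex.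
  exists P, Q; split; [exact: pP|exact: pQ| |].
  + have -> : 1%:M - ptrans (P + Q) = Z; last exact: pZ.
    move/eqP: D0; rewrite /D subr_eq0 => /eqP /(congr1 (@ptrans R A B)).
    by rewrite ptransD ptransK ptrans1 => <-; rewrite addrC addKr.
  + by apply/eqP; rewrite -subr_eq0; apply/eqP.
- pose s := real_complex R (- u)^-1.
  have s0 : 0 <= s by rewrite ler0c invr_ge0 oppr_ge0 ltW.
  have sH : s *: (real_complex R u *: H) = - H.
    rewrite scalerA -rmorphM /= -[u in _ * u]opprK mulrN mulVf ?oppr_eq0 ?lt_eqF //.
    by rewrite rmorphN rmorph1 scaleN1r.
  have bS : between (s *: D) H.
    apply/betweenE; split.
      by rewrite -[H]opprK -sH -scalerBr; exact: psdZ s0 pDm.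
    by rewrite -sH -scalerDr; exact: psdZ s0 pDp.
  have pS : psd (ptrans (s *: D)) by rewrite ptransZ; exact: psdZ s0 pDt.
  have := lb _ (psd_herm (psdZ s0 pD)) bS pS.
  rewrite -rdot1 rdotZl mulrC ler_pdivlMr ?oppr_gt0 // => le_b.
  have : 0 < u ^+ 2 by rewrite exprn_even_gt0 //= lt_eqF.
  by move: stat le_b; rewrite mulrN [b * u]mulrC; clear -DD0; lra.
- have : 0 < u ^+ 2 by rewrite exprn_even_gt0 //= gt_eqF.
  have : 0 <= u * b by rewrite mulr_ge0 // ltW.
  by move: stat; clear -DD0 D1; lra.
Qed.

(** For [Y >= 0] with dephasing partner [M], positivity of [X] against [(Y + M)^G] gives
    [Tr (X^G Y) >= - Tr (X^G M)], and [X^G <= 1] bounds this below by [- Tr M = - Tr Y]. *)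
Lemma qubit_ptrans_lower (A B : finType) (hAB : minn #|A| #|B| = 2%N)
    (X : op R (A * B)) :
  psd X -> psd (1%:M - ptrans X) -> psd (1%:M + ptrans X).
Proof.
move=> pX pX1; have h1 := psd_herm (psd1 (R := R) #|{: A * B}|).
apply: (psd_rdot (hermD h1 (herm_ptrans (psd_herm pX)))) => Y pY.
have [M [pM tM pYM]] := qubit_dephasing hAB pY.
have h := rdot_psd pX pYM; have k := rdot_psd pX1 pM.
rewrite -rdot_ptransl rdotDr in h.
rewrite rdotBl [rdot 1%:M M]rdotC rdot1 tM in k.
by rewrite rdotDl [rdot 1%:M Y]rdotC rdot1; lra.
Qed.

End Duality.

(** * Tensor powers *)

Section TensorPower.
Context {R : realType}.
Local Notation C := R[i].
Opaque psd.

Lemma entry_tpow (A B : finType) (X : op R (A * B)) n x y :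
  entry (tpow X n) x y = \prod_(t < n) entry X (x.1 t, x.2 t) (y.1 t, y.2 t).
Proof. exact: entry_mkop. Qed.

Lemma ptrans_tpow (A B : finType) (X : op R (A * B)) n :
  ptrans (tpow X n) = tpow (ptrans X) n.
Proof.
apply: op_ext => x y; rewrite entry_ptrans !entry_tpow.
by apply: eq_bigr => t _; rewrite entry_ptrans.
Qed.

Lemma prod_eq_ffun (n : nat) (T : finType) (f g : {ffun 'I_n -> T}) :
  \prod_t (f t == g t)%:R = (f == g)%:R :> C.
Proof.
have [->|nfg] := eqVneq f g; first by rewrite big1 // => t _; rewrite eqxx.
have [t nt] : exists t, f t != g t.
  apply/existsP; apply: contraNT nfg; rewrite negb_exists => /forallP h.
  by apply/eqP/ffunP => t; apply/eqP; rewrite -[_ == _]negbK.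
by rewrite (bigD1 t) //= (negbTE nt) mul0r.
Qed.

Lemma tpow1 (A B : finType) n : tpow (1%:M : op R (A * B)) n = 1%:M.
Proof.
apply: op_ext => -[x1 x2] [y1 y2]; rewrite entry_tpow entry1 xpair_eqE /=.
rewrite -mulnb natrM -!prod_eq_ffun -big_split; apply: eq_bigr => t _.
by rewrite entry1 xpair_eqE -mulnb natrM.
Qed.

Lemma sum_ffun_pair (A B : finType) n (g : 'I_n -> A * B -> C) :
  \sum_(x : {ffun 'I_n -> A} * {ffun 'I_n -> B}) \prod_t g t (x.1 t, x.2 t) =
  \prod_t \sum_p g t p.
Proof.
rewrite -(pair_bigA _ (fun (x1 : {ffun 'I_n -> A}) (x2 : {ffun 'I_n -> B}) =>
  \prod_t g t (x1 t, x2 t))) /=.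
under eq_bigr => x1 _ do rewrite -(bigA_distr_bigA (fun t b => g t (x1 t, b))).
rewrite -(bigA_distr_bigA (fun t a => \sum_b g t (a, b))).
apply: eq_bigr => t _; rewrite pair_bigA.
by apply: eq_bigr => -[a b] _.
Qed.

Lemma tr_tpowM (A B : finType) (X Y : op R (A * B)) n :
  \tr (tpow X n *m tpow Y n) = \tr (X *m Y) ^+ n.
Proof.
rewrite !tr_mul_entry.
pose g p q := entry X p q * entry Y q p.
under eq_bigr => x _ do under eq_bigr => y _ do
  rewrite !entry_tpow -big_split /= -/(g _ _).
under eq_bigr => x _ do
  rewrite (sum_ffun_pair (fun t q => g (x.1 t, x.2 t) q)).
rewrite (sum_ffun_pair (fun t p => \sum_q g p q)).
by rewrite prodr_const card_ord.
Qed.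

Lemma tr_tpow (A B : finType) (X : op R (A * B)) n :
  \tr (tpow X n) = \tr X ^+ n.
Proof. by rewrite -[tpow X n]mulmx1 -(tpow1 A B n) tr_tpowM mulmx1. Qed.

Lemma psd_tprod (A B : finType) n (M : 'I_n -> op R (A * B)) :
  (forall t, psd (M t)) ->
  psd (mkop (fun x y : {ffun 'I_n -> A} * {ffun 'I_n -> B} =>
    \prod_t entry (M t) (x.1 t, x.2 t) (y.1 t, y.2 t))).
Proof.
move=> pM; have /choice[c cE] t := psd_entryP (pM t).
apply: (psd_entry (c := fun (k : {ffun 'I_n -> A * B})
    (x : {ffun 'I_n -> A} * {ffun 'I_n -> B}) =>
  \prod_t c t (k t) (x.1 t, x.2 t))) => x y.
rewrite entry_mkop; under eq_bigr => t _ do rewrite cE.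
rewrite bigA_distr_bigA; apply: eq_bigr => k _.
by rewrite rmorph_prod -big_split.
Qed.

Lemma psd_tpow (A B : finType) (X : op R (A * B)) n : psd X -> psd (tpow X n).
Proof. by move=> pX; exact: (psd_tprod (M := fun=> X)). Qed.

(* With [S = P + Q] and [X = P - Q], both [tpow S n + tpow X n] and
   [tpow S n - tpow X n] expand into tensor products of copies of [P] and [Q]
   with coefficients [0] or [2]. *)
Lemma tpow_between (A B : finType) (S X : op R (A * B)) n :
  between S X -> between (tpow S n) (tpow X n).
Proof.
move=> /betweenE[p q].
(* [M false] and [M true] are [P] and [Q], which enter [X] with signs [1] and [-1]. *)
pose M (b : bool) := 2^-1 *: (if b then S - X else S + X).
have pM b : psd (M b) by case: b; apply: psd_half; [exact: q | exact: p].
have SE x y : entry S x y = \sum_b entry (M b) x y.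
  rewrite big_bool /= !entryZ entryB entryD.
  by move: (entry S x y) (entry X x y) => s z; field.
have XE x y : entry X x y = \sum_(b : bool) (-1) ^+ b * entry (M b) x y.
  rewrite big_bool /= !entryZ entryB entryD expr1 expr0.
  by move: (entry S x y) (entry X x y) => s z; field.
clearbody M.
pose T (f : {ffun 'I_n -> bool}) := mkop (fun x y : {ffun 'I_n -> A} * {ffun 'I_n -> B} =>
  \prod_t entry (M (f t)) (x.1 t, x.2 t) (y.1 t, y.2 t)) :
  op R ({ffun 'I_n -> A} * {ffun 'I_n -> B}).
pose s (f : {ffun 'I_n -> bool}) : C := \prod_t (-1) ^+ f t.
have pT f : psd (T f) by exact: psd_tprod (fun t => pM (f t)).
have sE f : s f = 1 \/ s f = -1.
  apply: (big_ind (fun z : C => z = 1 \/ z = -1)); first by left.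
    by move=> ? ? [->|->] [->|->]; rewrite ?mulr1 ?mul1r ?mulN1r ?opprK; auto.
  by move=> t _; case: (f t); [right|left].
have SnE : tpow S n = \sum_f T f.
  apply: op_ext => x y; rewrite entry_tpow entry_sum.
  under eq_bigr => t _ do rewrite SE.
  by rewrite bigA_distr_bigA; apply: eq_bigr => f _; rewrite entry_mkop.
have XnE : tpow X n = \sum_f s f *: T f.
  apply: op_ext => x y; rewrite entry_tpow entry_sum.
  under eq_bigr => t _ do rewrite XE.
  rewrite bigA_distr_bigA; apply: eq_bigr => f _.
  by rewrite entryZ entry_mkop -big_split.
apply/betweenE; split.
- rewrite SnE XnE -big_split; apply: psd_sum => f /=.
  case: (sE f) => ->; first by rewrite scale1r; exact: psdD (pT f) (pT f).
  by rewrite scaleN1r subrr; exact: psd0.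
- rewrite SnE XnE -sumrB; apply: psd_sum => f /=.
  case: (sE f) => ->; first by rewrite scale1r subrr; exact: psd0.
  by rewrite scaleN1r opprK; exact: psdD (pT f) (pT f).
Qed.

End TensorPower.

(** * Channels *)

Section Channels.
Context {R : realType}.
Local Notation C := R[i].
Opaque psd ptrans.

(** Ampliation by a one-dimensional system is the map itself, up to relabelling ['I_1 * I] as
    [I]. *)
Lemma cp_positive (I J : finType) (L : op R I -> op R J) X :
  completely_positive L -> psd X -> psd (L X).
Proof.
move=> [_ /(_ 1%N) cpL] /psd_entryP[c cE].
have e (Y : op R ('I_1 * I)) a b :
    mkop (fun i j => entry Y (a, i) (b, j)) =
    mkop (fun i j => entry Y (ord0, i) (ord0, j)).
  by rewrite !ord1.
pose X1 : op R ('I_1 * I) := mkop (fun x y => entry X x.2 y.2).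
have /cpL/psd_entryP[d dE] : psd X1.
  apply: (psd_entry (c := fun k (x : 'I_1 * I) => c k x.2)) => x y.
  by rewrite entry_mkop.
apply: (psd_entry (c := fun k j => d k (ord0, j))) => x y.
rewrite -dE entry_mkop /=; congr (entry (L _) _ _).
by apply: op_ext => i j; rewrite !entry_mkop.
Qed.

Lemma cpD (I J : finType) (L M : op R I -> op R J) :
  completely_positive L -> completely_positive M ->
  completely_positive (fun X => L X + M X).
Proof.
move=> [lL pL] [lM pM]; split=> [a X Y|k X pX].
  by rewrite lL lM scalerDr addrACA.
have -> : ampliation (fun X => L X + M X) X = ampliation L X + ampliation M X.
  by apply: op_ext => x y; rewrite entryD !entry_mkop entryD.
exact: psdD (pL k X pX) (pM k X pX).
Qed.

Lemma exchange_big4 (I J K L : finType) (F : I -> J -> K -> L -> C) :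
  \sum_i \sum_j \sum_k \sum_l F i j k l = \sum_k \sum_l \sum_i \sum_j F i j k l.
Proof.
transitivity (\sum_q \sum_r F q.1 q.2 r.1 r.2).
  by rewrite pair_bigA; apply: eq_bigr => q _; rewrite pair_bigA.
rewrite exchange_big [RHS]pair_bigA.
by apply: eq_bigr => r _; rewrite pair_bigA.
Qed.

(** Gram vectors of the output are products of those of [T] with [w], the contraction over [I] of a
    Gram vector of [X] against one of [E]. *)
Lemma cp_measure_prepare (I J : finType) (E : op R I) (T : op R J) :
  psd E -> psd T -> completely_positive (fun X : op R I => \tr (X *m E) *: T).
Proof.
move=> pE pT; split=> [a X Y|k X /psd_entryP[c cE]].
  by rewrite mulmxDl -scalemxAl mxtraceD mxtraceZ scalerDl scalerA.
have [e eE] := psd_entryP pE; have [t tE] := psd_entryP pT.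
pose w l p (a : 'I_k) : C := \sum_i c l (a, i) * (e p i)^*.
apply: (psd_entry (c := fun (q : (('I_k * I) * I) * J) (x : 'I_k * J) =>
  w q.1.1 q.1.2 x.1 * t q.2 x.2)) => x y.
rewrite -(pair_bigA _ (fun (q : ('I_k * I) * I) r => w q.1 q.2 x.1 * t r x.2 *
  (w q.1 q.2 y.1 * t r y.2)^*)) /=.
rewrite entry_mkop entryZ tE tr_mul_entry.
have -> : \sum_i \sum_j entry (mkop (fun i j => entry X (x.1, i) (y.1, j))) i j
    * entry E j i = \sum_(q : ('I_k * I) * I) w q.1 q.2 x.1 * (w q.1 q.2 y.1)^*.
  rewrite -(pair_bigA _ (fun l p => w l p x.1 * (w l p y.1)^*)) /=.
  transitivity (\sum_i \sum_j \sum_l \sum_p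
      (c l (x.1, i) * (e p i)^*) * (c l (y.1, j) * (e p j)^*)^*).
    apply: eq_bigr => i _; apply: eq_bigr => j _.
    rewrite entry_mkop cE eE big_distrl; apply: eq_bigr => l _ /=.
    rewrite big_distrr; apply: eq_bigr => p _ /=.
    by rewrite rmorphM /= conjCK; ring.
  rewrite exchange_big4; apply: eq_bigr => l _; apply: eq_bigr => p _.
  rewrite /w rmorph_sum big_distrl; apply: eq_bigr => i _ /=.
  by rewrite big_distrr.
rewrite big_distrl; apply: eq_bigr => q _ /=.
rewrite big_distrr; apply: eq_bigr => r _ /=.
by rewrite rmorphM /=; ring.
Qed.


(* The maximally entangled state; see [tpow_Phi2]. *)
Definition maxent (D : finType) : op R (D * D) :=
  mkop (fun x y => (x.1 == x.2)%:R * (y.1 == y.2)%:R / #|D|%:R).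

Definition swap (D : finType) : op R (D * D) :=
  mkop (fun x y => ((x.1, x.2) == (y.2, y.1))%:R).

Lemma sum_diag (D : finType) (F : D * D -> C) :
  \sum_z (z.1 == z.2)%:R * F z = \sum_a F (a, a).
Proof.
transitivity (\sum_(z : D * D) (z.1 == z.2)%:R * F (z.1, z.2)).
  by apply: eq_bigr => -[a b].
rewrite -(pair_bigA _ (fun a b => (a == b)%:R * F (a, b))) /=.
apply: eq_bigr => a _; rewrite (bigD1 a) //= eqxx mul1r big1 ?addr0 // => b.
by rewrite eq_sym => /negbTE ->; rewrite mul0r.
Qed.

Lemma maxent_idem (D : finType) : (0 < #|D|)%N ->
  maxent D *m maxent D = maxent D.
Proof.
move=> D0; have d0 : #|D|%:R != 0 :> C by rewrite pnatr_eq0 -lt0n.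
apply: op_ext => x y; rewrite entry_mul entry_mkop.
transitivity (\sum_(z : D * D) (z.1 == z.2)%:R *
  ((x.1 == x.2)%:R * (y.1 == y.2)%:R / #|D|%:R ^+ 2 * (z.1 == z.2)%:R) : C).
  by apply: eq_bigr => z _; rewrite !entry_mkop; field.
rewrite sum_diag /=; under eq_bigr do rewrite eqxx mulr1.
by rewrite sumr_const -mulr_natr; field.
Qed.

Lemma tr_maxent (D : finType) : (0 < #|D|)%N -> \tr (maxent D) = 1.
Proof.
move=> D0; have d0 : #|D|%:R != 0 :> C by rewrite pnatr_eq0 -lt0n.
rewrite tr_entry.
transitivity (\sum_(z : D * D) (z.1 == z.2)%:R *
  ((z.1 == z.2)%:R / #|D|%:R) : C).
  by apply: eq_bigr => z _; rewrite entry_mkop mulrA.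
rewrite sum_diag /=; under eq_bigr do rewrite eqxx mul1r.
by rewrite sumr_const -mulr_natr; field.
Qed.

Lemma maxent_herm (D : finType) : maxent D \is hermsymmx.
Proof.
apply/herm_entry => x y; rewrite !entry_mkop !rmorphM /= fmorphV /= !rmorph_nat.
by congr (_ / _); rewrite mulrC.
Qed.

Lemma psd_projector (n : nat) (E : 'M[C]_n) :
  E \is hermsymmx -> E *m E = E -> psd E.
Proof. by move=> /hermP hE EE; rewrite -EE {2}hE; exact: psd_gram. Qed.

Lemma psd_maxent (D : finType) : (0 < #|D|)%N -> psd (maxent D).
Proof.
by move=> D0; exact: psd_projector (maxent_herm D) (maxent_idem D0).
Qed.

Lemma psd_maxentC (D : finType) : (0 < #|D|)%N -> psd (1%:M - maxent D).
Proof.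
move=> D0; apply: psd_projector.
  exact: hermB (psd_herm (psd1 _)) (maxent_herm D).
by rewrite mulmxBl !mulmxBr !mulmx1 mul1mx (maxent_idem D0) subrr subr0.
Qed.

Lemma ptrans_maxent (D : finType) :
  ptrans (maxent D) = #|D|%:R^-1 *: swap D.
Proof.
apply: op_ext => x y; rewrite entry_ptrans entryZ !entry_mkop /=.
by rewrite xpair_eqE -mulnb natrM mulrC [y.1 == _]eq_sym.
Qed.

Lemma swap_sqr (D : finType) : swap D *m swap D = 1%:M.
Proof.
apply: op_ext => -[x1 x2] [y1 y2]; rewrite entry_mul (bigD1 (x2, x1)) //=.
rewrite !entry_mkop /= eqxx mul1r entry1 big1 ?addr0 => [|[z1 z2] nz].
  by rewrite !xpair_eqE andbC.
rewrite entry_mkop /= xpair_eqE; move: nz; rewrite xpair_eqE andbC.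
by rewrite (eq_sym z1) (eq_sym z2) => /negbTE ->; rewrite mul0r.
Qed.

Lemma swap_herm (D : finType) : swap D \is hermsymmx.
Proof.
apply/herm_entry => x y; rewrite !entry_mkop rmorph_nat !xpair_eqE andbC.
by rewrite (eq_sym y.1) (eq_sym y.2).
Qed.

Lemma half_double (n : nat) (X : 'M[C]_n) : 2^-1 *: (X + X) = X.
Proof.
by rewrite -mulr2n -[X *+ 2]scaler_nat scalerA mulVf ?two_neq0 // scale1r.
Qed.

(** [X] is half the Gram matrix [X *m X ^t*]. This serves [1 + swap] and [1 - swap], as [swap]
    squares to [1]. *)
Lemma psd_of_sqr (n : nat) (X : 'M[C]_n) :
  X \is hermsymmx -> X *m X = X + X -> psd X.
Proof.
move=> /hermP hX XX; rewrite -[X]half_double -XX {2}hX.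
by apply: psd_half; exact: psd_gram.
Qed.

Lemma psd_swapD (D : finType) : psd (1%:M + swap D).
Proof.
apply: psd_of_sqr; first exact: hermD (psd_herm (psd1 _)) (swap_herm D).
rewrite mulmxDl !mulmxDr !mulmx1 mul1mx swap_sqr.
by congr (_ + _); rewrite addrC.
Qed.

Lemma psd_swapB (D : finType) : psd (1%:M - swap D).
Proof.
apply: psd_of_sqr; first exact: hermB (psd_herm (psd1 _)) (swap_herm D).
rewrite mulmxBl !mulmxBr !mulmx1 mul1mx swap_sqr.
by congr (_ + _); rewrite opprB.
Qed.

(** The entangled pairs become one maximally entangled state, so the channel lemmas can work over an
    arbitrary [D]. *)
Lemma tpow_Phi2 m : tpow (Phi2 R) m = maxent {ffun 'I_m -> 'I_2}.
Proof.
have PE x y : entry (Phi2 R) x y = (x.1 == x.2)%:R * (y.1 == y.2)%:R / 2.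
  rewrite /entry mxE big_ord1 !mxE !enum_rankK rmorphM /= rmorph_nat.
  have -> : ((sqrtC 2)^-1)^* = (sqrtC (2 : C))^-1.
    by apply: geC0_conj; rewrite invr_ge0 sqrtC_ge0 ler0n.
  rewrite mulrACA -invfM -expr2 sqrtCK; done.
apply: op_ext => x y; rewrite entry_tpow entry_mkop.
under eq_bigr => t _ do rewrite PE /=.
rewrite !big_split /= !prod_eq_ffun prodr_const card_ord exprVn.
by rewrite card_ffun !card_ord natrX.
Qed.

End Channels.

(** * PPT channels acting on a maximally entangled state *)

Section Cost.
Context {R : realType}.
Local Notation C := R[i].
Opaque psd ptrans.
Local Notation RC := (real_complex R).

Lemma herm_tr_real (n : nat) (X : 'M[C]_n) :
  X \is hermsymmx -> \tr X = RC (complex.Re (\tr X)).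
Proof.
move=> hX; apply: conj_fixedE.
by rewrite -{1}(mulmx1 X) (herm_trM_real hX (psd_herm (psd1 _))) mulmx1.
Qed.

Lemma ppt_dilution (D A B : finType) (rho S : op R (A * B)) :
  (0 < #|D|)%N -> state rho -> psd S -> between S (ptrans rho) ->
  psd (ptrans S) -> complex.Re (\tr S) + 1 <= #|D|%:R ->
  exists L : op R (D * D) -> op R (A * B), ppt_channel L /\ L (maxent D) = rho.
Proof.
move=> D0 [pr tr1] pS /betweenE[Sp Sm] pSt leK.
pose s := complex.Re (\tr S).
have trS : \tr S = RC s by exact: herm_tr_real (psd_herm pS).
have s1 : 1 <= s.
  have := psd_tr_ge0 Sm; rewrite raddfB /= tr_ptrans tr1 trS subr_ge0.
  by rewrite -(rmorph1 RC) lecR.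
pose K : R := #|D|%:R; pose q := K^-1; pose v := s^-1.
have s0 : 0 < s by lra.
have K0 : 0 < K by rewrite /K; lra.
have q0 : 0 <= q by rewrite invr_ge0 ltW.
have v0 : 0 <= v by rewrite invr_ge0 ltW.
(* Clearing denominators turns this into [s + 1 <= K]. *)
have qv : q <= v * (1 - q).
  rewrite -(ler_pM2r s0) -(ler_pM2l K0) mulrA /q /v mulfV ?gt_eqF // mul1r.
  have -> : K * (s^-1 * (1 - K^-1) * s) = K - 1 by field; rewrite !gt_eqF.
  by rewrite lerBrDr.
have qv' : q <= v * (1 + q) by apply: le_trans qv _; rewrite ler_wpM2l // lerD2l; lra.
pose sigma := RC v *: ptrans S.
have tr_sigma : \tr sigma = 1.
  by rewrite mxtraceZ tr_ptrans trS -rmorphM mulVf ?gt_eqF // rmorph1.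
have psigma : psd sigma by apply: psdZ pSt; rewrite ler0c.
have sigmaE : ptrans sigma = RC v *: S by rewrite /sigma ptransZ ptransK.
clearbody sigma.
have E1 := psd_maxent (R := R) D0; have E2 := psd_maxentC (R := R) D0.
pose L (X : op R (D * D)) :=
  \tr (X *m maxent D) *: rho + \tr (X *m (1%:M - maxent D)) *: sigma.
exists L; split; last first.
  rewrite /L mulmxBr mulmx1 maxent_idem // subrr tr_maxent // scale1r.
  by rewrite raddf0 scale0r addr0.
split; last first.
  move=> X; rewrite /L mxtraceD !mxtraceZ tr1 tr_sigma !mulr1 -mxtraceD.
  by rewrite -mulmxDr addrC subrK mulmx1.
split.
  apply: cpD; first exact: cp_measure_prepare E1 pr.
  exact: cp_measure_prepare E2 psigma.
(* The partially transposed channel measures the projectors [(1 + swap) / 2] and [(1 - swap) / 2]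
   and prepares [v (1 - q) S + q rho^G] or [v (1 + q) S - q rho^G]. These are [T1] and [T2], written
   as sums of positive terms. *)
pose T1 := RC q *: (S + ptrans rho) + RC (v * (1 - q) - q) *: S.
pose T2 := RC q *: (S - ptrans rho) + RC (v * (1 + q) - q) *: S.
have pT1 : psd T1.
  have c1 : 0 <= RC q by rewrite ler0c.
  have c2 : 0 <= RC (v * (1 - q) - q) by rewrite ler0c subr_ge0.
  exact: psdD (psdZ c1 Sp) (psdZ c2 pS).
have pT2 : psd T2.
  have c1 : 0 <= RC q by rewrite ler0c.
  have c2 : 0 <= RC (v * (1 + q) - q) by rewrite ler0c subr_ge0.
  exact: psdD (psdZ c1 Sm) (psdZ c2 pS).
have -> : (fun X : op R (D * D) => ptrans (L (ptrans X))) = fun X =>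
    \tr (X *m (2^-1 *: (1%:M + swap D))) *: T1
      + \tr (X *m (2^-1 *: (1%:M - swap D))) *: T2.
  apply/funext => X; rewrite /L ptransD !ptransZ sigmaE !tr_ptransMl ptransB ptrans1.
  rewrite ptrans_maxent mulmxBr mulmx1 -!scalemxAr mulmxBr mulmxDr mulmx1.
  rewrite !mxtraceZ !raddfB /= mxtraceD mxtraceZ.
  have -> : #|D|%:R^-1 = RC q by rewrite /q /K fmorphV rmorph_nat.
  rewrite /T1 /T2; clear; apply: op_ext => x y.
  rewrite !(entryB, entryD, entryZ).
  rewrite !rmorphB !rmorphM !rmorphB !rmorphD !rmorph1 /=.
  move: (\tr X) (\tr (X *m swap D)) (entry S x y) (entry (ptrans rho) x y).
  by move: (RC q) (RC v) => a b t f z w; field.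
apply: cpD.
  exact: cp_measure_prepare (psd_half (psd_swapD D)) pT1.
exact: cp_measure_prepare (psd_half (psd_swapB D)) pT2.
Qed.

(** Let [G] be the partially transposed channel and [S = G 1 / #|D|]. Since [rho^G] is the image of
    [swap] under [G], divided by [#|D|], the bounds [-1 <= swap <= 1] pass to [S]. Moreover
    [S^G = L 1 / #|D|] is positive, and its trace is [#|D|^2 / #|D|]. *)
Lemma ppt_converse (D A B : finType) (rho : op R (A * B))
    (L : op R (D * D) -> op R (A * B)) :
  (0 < #|D|)%N -> ppt_channel L -> L (maxent D) = rho ->
  exists S : op R (A * B), [/\ psd S, between S (ptrans rho),
    psd (ptrans S) & complex.Re (\tr S) = #|D|%:R].
Proof.
move=> D0 [[cpL cpG] tpL] Lrho.
have d0 : #|D|%:R != 0 :> C by rewrite pnatr_eq0 -lt0n.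
set G := fun X : op R (D * D) => ptrans (L (ptrans X)) in cpG.
have q0 : 0 <= (#|D|%:R^-1 : C) by rewrite invr_ge0 ler0n.
have lG := proj1 cpG.
have GE : ptrans rho = #|D|%:R^-1 *: G (swap D).
  have G0 : G 0 = 0.
    have := lG 1 0 0; rewrite scaler0 addr0 scale1r => /eqP.
    by rewrite -subr_eq0 opprD addrA subrr sub0r oppr_eq0 => /eqP.
  rewrite -[RHS]addr0 -G0 -lG addr0 -ptrans_maxent /G ptransK.
  by rewrite Lrho.
exists (#|D|%:R^-1 *: G 1%:M); split.
- exact: psdZ q0 (cp_positive cpG (psd1 _)).
- apply/betweenE; rewrite GE -scalerBr -scalerDr; split; apply: (psdZ q0).
    rewrite -[G 1%:M]scale1r -lG scale1r.
    exact: cp_positive cpG (psd_swapD D).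
  rewrite addrC -scaleN1r -lG scaleN1r addrC.
  exact: cp_positive cpG (psd_swapB D).
- rewrite ptransZ /G ptransK ptrans1.
  exact: psdZ q0 (cp_positive cpL (psd1 _)).
- rewrite mxtraceZ /G tr_ptrans tpL tr_ptrans mxtrace1 card_prod natrM mulKf //.
  by rewrite -(rmorph_nat RC).
Qed.

End Cost.

(** * Rates *)

Section Bounds.
Context {R : realType}.
Local Notation C := R[i].
Opaque psd ptrans.
Local Notation RC := (real_complex R).

(** Weak duality: [2 (<W, S> - <D, H>) = <W + D, S - H> + <W - D, S + H>], and both terms pair
    positive matrices. *)
Lemma between_rdot_le (n : nat) (W D S H : 'M[C]_n) :
  between W D -> between S H -> rdot D H <= rdot W S.
Proof.
move=> /betweenE[p q] /betweenE[p' q'].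
have h1 := rdot_psd p q'; have h2 := rdot_psd q p'.
have : 0 <= 2 * (rdot W S - rdot D H).
  have -> : 2 * (rdot W S - rdot D H) =
    rdot (W + D) (S - H) + rdot (W - D) (S + H).
    rewrite rdotDl rdotBl !rdotBr !rdotDr.
    by move: (rdot W S) (rdot D H) (rdot W H) (rdot D S) => x y z t; ring.
  exact: addr_ge0.
by rewrite pmulr_rge0 ?ltr0n // subr_ge0.
Qed.

Lemma inf_minimum (V : set R) (m : R) : V m -> lbound V m -> inf V = m.
Proof.
move=> Vm lm; apply/le_anti/andP; split.
  by apply: ge_inf => //; exists m.
by apply: lb_le_inf => //; exists m.
Qed.

Section Rates.
Context (A B : finType) (rho : op R (A * B)) (m : R).
Context (hAB : minn #|A| #|B| = 2%N) (hrho : state rho).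

Lemma kappa_ge1 : kappa_values rho m -> 1 <= m.
Proof.
move=> [S [hS /betweenE[_ q] _ ->]]; have [pr tr1] := hrho.
have := psd_tr_ge0 q; rewrite raddfB /= tr_ptrans tr1 subr_ge0 => /Re_le.
by [].
Qed.

(* The dual optimum of a single copy is multiplicative: its tensor powers are
   feasible for [n] copies because [qubit_ptrans_lower] bounds the partial
   transpose on both sides. *)
Lemma kappa_tpow_ge n (S : op R ({ffun 'I_n -> A} * {ffun 'I_n -> B})) :
  0 <= m -> lbound (kappa_values rho) m -> between S (ptrans (tpow rho n)) ->
  psd (ptrans S) -> m ^+ n <= complex.Re (\tr S).
Proof.
move=> m0 lb bS pS; have [pr _] := hrho.
have hH := herm_ptrans (psd_herm pr).
have [|P [Q [pP pQ pPQ PQ]]] := sdp_duality hH m0.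
  by move=> T hT bT pT; apply: lb; exists T.
set W := P + Q in pPQ; set D := P - Q in PQ.
have pW : psd W by exact: psdD pP pQ.
have bW : between W D.
  apply/betweenE; rewrite /W /D; split.
    by rewrite addrACA subrr addr0; exact: (psdD pP pP).
  by rewrite opprB [Q - P]addrC addrACA subrr add0r; exact: (psdD pQ pQ).
have b1 : between 1%:M (ptrans W).
  apply/betweenE; split; last exact: pPQ.
  exact (qubit_ptrans_lower hAB pW pPQ).
have hD : D \is hermsymmx by exact: hermB (psd_herm pP) (psd_herm pQ).
have trD : \tr (D *m ptrans rho) = RC m.
  by rewrite -PQ; apply: conj_fixedE; exact: herm_trM_real hD hH.
have -> : m ^+ n = rdot (tpow D n) (ptrans (tpow rho n)).
  by rewrite ptrans_tpow /rdot tr_tpowM trD -rmorphXn.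
(* With tensor powers throughout, the chain is [m^n = <D^n, (rho^G)^n> <= <W^n, S> = <(W^n)^G, S^G>
   <= Tr S]. *)
apply: le_trans (between_rdot_le (tpow_between n bW) bS) _.
have /betweenE[_ pn] := tpow_between n b1; rewrite tpow1 -ptrans_tpow in pn.
have := rdot_psd pn pS.
by rewrite rdotBl subr_ge0 rdot_ptransl ptransK [rdot 1%:M _]rdotC rdot1 tr_ptrans.
Qed.

Lemma card_qubits k : #|{ffun 'I_k -> 'I_2}| = (2 ^ k)%N.
Proof. by rewrite card_ffun !card_ord. Qed.

(** A single number [n] of copies suffices: [m ^ n <= 2 ^ k] and [k <= r * n], so taking logarithms
    and dividing by [n] gives the bound. *)
Lemma achievable_ge r :
  kappa_values rho m -> lbound (kappa_values rho) m ->
  achievable rho r -> log2 m <= r.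
Proof.
move=> km lb [r0 [N _ hN]]; have m1 := kappa_ge1 km.
have m0 : 0 < m by exact: lt_le_trans m1.
(* The successor makes the number of copies positive, so that it can be divided out. *)
have [L [pL Lrho]] := hN N.+1 (leqnSn N).
move: L pL Lrho; rewrite tpow_Phi2; set k := Num.truncn _ => L pL Lrho.
have D0 : (0 < #|{ffun 'I_k -> 'I_2}|)%N by rewrite card_qubits expn_gt0.
have [S [_ bS pS trS]] := ppt_converse D0 pL Lrho.
have := kappa_tpow_ge (ltW m0) lb bS pS; rewrite trS card_qubits natrX => le_m.
have ln2 : 0 < ln 2 :> R by rewrite ln_gt0 // ltr1n.
have kr : k%:R <= r * N.+1%:R by rewrite truncn_le // mulr_ge0.
have : ln m *+ N.+1 <= ln 2 *+ k.
  by rewrite -!lnXn ?ltr0n // ler_ln ?posrE ?exprn_gt0 ?ltr0n.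
rewrite -[_ *+ N.+1]mulr_natr -[_ *+ k]mulr_natr => le_ln.
rewrite /log2 ler_pdivrMr // -(ler_pM2r (ltr0Sn R N)).
apply: le_trans le_ln _; rewrite mulrC mulrAC.
by rewrite ler_wpM2r // ltW.
Qed.

Lemma achievable_gt r : kappa_values rho m -> log2 m < r -> achievable rho r.
Proof.
move=> km lt_r; have m1 := kappa_ge1 km.
have m0 : 0 < m by exact: lt_le_trans m1.
have ln2 : 0 < ln 2 :> R by rewrite ln_gt0 // ltr1n.
have lnm : 0 <= ln m by rewrite ln_ge0.
have r0 : 0 <= r by apply: ltW; apply: le_lt_trans lt_r; rewrite divr_ge0 // ltW.
have d0 : 0 < r * ln 2 - ln m by rewrite subr_gt0 -ltr_pdivrMr.
have [pr tr1] := hrho; have [S [hS bS pS mE]] := km.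
split=> //; near=> n.
(* The surplus [n (r ln 2 - ln m)] must cover [2 ln 2]: one [ln 2] for rounding [r * n] down to [k],
   the other for [m ^ n + 1 <= 2 * m ^ n]. *)
have le_n : 2 * ln 2 / (r * ln 2 - ln m) <= n%:R by near: n; exact: nbhs_infty_ger.
rewrite ler_pdivrMr // in le_n.
rewrite tpow_Phi2; set k := Num.truncn _.
have kr : r * n%:R < k.+1%:R by rewrite truncnS_gt.
have D0 : (0 < #|{ffun 'I_k -> 'I_2}|)%N by rewrite card_qubits expn_gt0.
have mn1 : 1 <= m ^+ n by rewrite exprn_ege1.
have le_m : m ^+ n + 1 <= 2 ^+ k.
  apply: (@le_trans _ _ (2 * m ^+ n)); first by lra.
  rewrite -ler_ln ?posrE ?mulr_gt0 ?exprn_gt0 ?ltr0n //.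
  rewrite lnM ?posrE ?exprn_gt0 ?ltr0n // !lnXn ?ltr0n //.
  rewrite -[ln m *+ n]mulr_natr -[_ *+ k]mulr_natr.
  have : r * n%:R * ln 2 <= k.+1%:R * ln 2 by rewrite ler_wpM2r // ltW.
  have -> : k.+1%:R * ln 2 = ln 2 * k%:R + ln 2 :> R by rewrite -natr1; ring.
  have eq_n : n%:R * (r * ln 2 - ln m) = r * n%:R * ln 2 - ln m * n%:R by ring.
  move: le_n; rewrite eq_n; clear.
  move: (ln 2) (r * n%:R * ln 2) (ln m * n%:R) (ln 2 * k%:R) => t x y z.
  by move=> h1 h2; lra.
have pSS : psd S by exact: between_psd hS bS.
have trS : \tr S = RC m by rewrite mE; exact: herm_tr_real hS.
apply: ppt_dilution D0 _ (psd_tpow n pSS) _ _ _.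
- by split; [exact: psd_tpow | rewrite tr_tpow tr1 expr1n].
- by rewrite ptrans_tpow; exact: tpow_between.
- by rewrite ptrans_tpow; exact: psd_tpow.
- by rewrite tr_tpow trS -rmorphXn /= card_qubits natrX.
Unshelve. all: by end_near.
Qed.

End Rates.
End Bounds.

(** * Attained minima and equality of the four quantities *)

Theorem corollary2 (R : realType) (A B : finType)
    (hAB : minn #|A| #|B| = 2%N) (rho : op R (A * B)) (hrho : state rho) :
  [/\ has_minimum (chi1_values rho),
      has_minimum (norm_values rho) &
      has_minimum (kappa_values rho)] /\
  [/\ exact_ppt_cost rho = (E_chi1 rho)%:E,
      E_chi1 rho = log2 (inf (norm_values rho)) &
      log2 (inf (norm_values rho)) = E_kappa rho].
Proof.
have [pr _] := hrho; have hr := psd_herm pr.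
have chiE : chi1_values rho = kappa_values rho.
  apply/seteqP; split; first exact: chi1_sub_kappa.
  by move=> m /kappa_sub_norm /norm_sub_chi1.
have normE : norm_values rho = kappa_values rho.
  apply/seteqP; split; last exact: kappa_sub_norm.
  by move=> m /norm_sub_chi1; rewrite chiE.
have kmin : has_minimum (kappa_values rho).
  apply: kappa_minimum => //; rewrite -normE; exact: norm_values_nonempty.
rewrite /E_chi1 /E_kappa chiE normE; split; split => //.
have [m km lb] := kmin; rewrite (inf_minimum km lb).
apply/le_anti/andP; split.
  (* Achievability is available for rates strictly above [log2 m], so the upper bound is proved up
     to an arbitrary [e > 0]. *)
  apply/lee_addgt0Pr => e e0; apply: ereal_inf_lbound.
  exists (log2 m + e) => //; apply: (achievable_gt hrho km).
  by rewrite ltrDl.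
apply/ereal_infP => _ [r ar <-]; rewrite lee_fin.
exact: (achievable_ge hAB hrho km lb ar).
Qed.
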